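(* Let $\mathcal{A}$ be a locally finite line arrangement in $\mathbb{R}^2$, let $x_0\in\mathbb{R}^2$ be a generic point with respect to $\mathcal{A}$, and let $\mathcal{M}$ be a Euclidean matching on $\mathrm{Sal}(\mathcal{A})$ with base point $x_0$. Let $\langle D,p\rangle$ be a critical $2$-cell and $\langle C,F\rangle$ a critical $1$-cell. Then their incidence number (in $\mathbb{Z}[t_\ell^{\pm1}]_{\ell\in\mathcal{A}}$) in the Morse complex is given by \[ [\langle D,p\rangle:\langle C,F\rangle]^{\mathcal{M}} =\sum_{s \in \mathrm{Seq}}\omega(s), \] where $\mathrm{Seq}$ is the set of sequences of codimension-$1$ faces of the form $(F_1\to F_2\to\dots\to F_n=F)$, $n\geq1$, such that $\langle C(F_1),F_1\rangle<\langle D,p\rangle$ in $\mathrm{Sal}(\mathcal{A})$, and for each sequence $s=(F_1 \to F_2 \to \dots \to F_n=F) \in \mathrm{Seq}$ we define \[ \omega(s)=(-1)^{n} \, [\langle D,p\rangle:\langle C(F_1),F_1\rangle] \, \prod_{i=1}^{n-1}[F_i \to F_{i+1}]. \]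
   Context: Arrangements. $\mathcal{A}$ is a locally finite set of lines in $\mathbb{R}^2$, and $M(\mathcal{A})\subseteq\mathbb{C}^2$ is the complement of the union of the complexified lines. Faces are the closures of the strata of the induced stratification of $\mathbb{R}^2$ (two points are in the same stratum iff, for each line, both lie on it or both lie strictly on the same side), ordered by $F\preceq G\iff F\supseteq G$; chambers are faces of codimension $0$, and $\mathcal{C}$ is the set of chambers. A wall of a chamber $C$ is a line of $\mathcal{A}$ meeting $C$ in a face of codimension $1$. $s(C,C')$ is the set of lines separating the chambers $C,C'$. $|F|$ is the affine span of $F$ and $\mathrm{supp}(F)$ the set of lines of $\mathcal{A}$ containing $F$. For a chamber $C$ and a face $F$, $C.F$ is the unique chamber $C'\supseteq F$ with $\mathrm{supp}(F)\cap s(C,C')=\emptyset$. If $F\subseteq C$, $C^F$ is the unique chamber $C'\supseteq F$ with $s(C,C')=\mathrm{supp}(F)$ (the opposite chamber). Salvetti complex. $\mathrm{Sal}(\mathcal{A})$ is (the poset of cells of) the Salvetti complex, a regular CW complex with a $k$-cell $\langle C,F\rangle$ for each chamber $C$ and face $F$ of $C$ of codimension $k$; $\langle C,F\rangle<\langle D,G\rangle$ iff $F\prec G$ and $D.F=C$. A $2$-cell $\langle D,\{p\}\rangle$ is written $\langle D,p\rangle$. $S(C)=\{\langle C',F\rangle\mid C'=C.F\}$; given a total order $\dashv$ of $\mathcal{C}$ (of the order type of the natural numbers if $\mathcal{C}$ is infinite), $N(C)$ is the set of cells of $S(C)$ not in any $S(C')$ with $C'\dashv C$. Matchings. A matching $\mathcal{M}$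 on $\mathrm{Sal}(\mathcal{A})$ is a set of Hasse diagram edges $(p,q)$ ($q<p$ with no cell strictly between) such that every cell appears in at most one of them; it is acyclic if orienting edges downwards when not in $\mathcal{M}$ and upwards when in $\mathcal{M}$ gives no directed cycle. Cells in no edge of $\mathcal{M}$ are critical. An alternating path is a directed path in this graph in which no two consecutive edges are both in $\mathcal{M}$ or both not in $\mathcal{M}$. Euclidean matchings. $d$ is the Euclidean distance and $\rho_K$ the projection onto a closed convex set $K$. A point $x$ is generic if: (i) for all $C,C'\in\mathcal{C}$ with $d(x,C)=d(x,C')$ we have $\rho_C(x)=\rho_{C'}(x)\in C\cap C'$; (ii) for all flats (nonempty intersections of lines of $\mathcal{A}$, including $\mathbb{R}^2$) $L'\subsetneq L$ we have $d(x,L')>d(x,L)$. A Euclidean order with base point $x_0$ is a total order $\dashv_{eu}$ of $\mathcal{C}$ such that $C\dashv_{eu}C'$ implies $d(x_0,C)\leq d(x_0,C')$, with $x_0$ generic. It induces $\eta\colon\mathrm{Sal}(\mathcal{A})\to\mathcal{C}\times\mathcal{C}$, $\eta(\langle D,F\rangle)=(C,D^F)$ where $\langle D,F\rangle\in N(C)$. An acyclic matching $\mathcal{M}$ is Euclidean with base point $x_0$ if $x_0$ is generic, matched cells have the same image under the map $\eta$ induced by a Euclidean order with base point $x_0$, and there is exactly one critical cell $\langle C,F_C\rangle$ for each chamber $C$, where $F_C$ is the smallest face of $C$ containing $\rho_C(x_0)$. $C_0$ is the chamber containing $x_0$; it is the first chamber in any such order. The sets $N(C)$ below are taken with respect to a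 Euclidean order with base point $x_0$ (they depend only on $x_0$). Twisted incidence numbers. Let $t_\ell$ ($\ell\in\mathcal{A}$) be commuting variables; $t_\ell$ corresponds to an elementary positive loop around $\ell$ acting on an abelian local system on $M(\mathcal{A})$. For chambers $D,C$ let $\bar u(D,C)=\prod t_\ell$, the product over $\ell\in s(C_0,C)\cap s(D,C)$. For an $i$-cell $\langle D,G\rangle$ and an $(i-1)$-cell $\langle C,F\rangle$ of $\mathrm{Sal}(\mathcal{A})$ put $[\langle D,G\rangle:\langle C,F\rangle]=[\langle D,G\rangle:\langle C,F\rangle]_{\mathbb{Z}}\,\bar u(D^G,C^F)$, where $[\cdot:\cdot]_{\mathbb{Z}}$ is the integral incidence number in $\mathrm{Sal}(\mathcal{A})$. Orientations: each $1$-cell $\langle C,F\rangle$ is oriented so that $[\langle C,F\rangle:\langle C^F,C^F\rangle]_{\mathbb{Z}}=1$. For a $2$-cell $\langle D,p\rangle\notin N(C_0)$, let $\ell$ be the wall of $D$ through $p$ not separating $D$ from $C_0$ if it exists, otherwise the one of the two walls of $D$ through $p$ closest to $x_0$; $\langle D,p\rangle$ is oriented so that $[\langle D,p\rangle:\langle D,D\cap\ell\rangle]_{\mathbb{Z}}=1$. The $2$-cells in $N(C_0)$ are oriented arbitrarily. Morse incidence numbers. For critical cells $\sigma,\tau$ with $\dim\sigma=\dim\tau+1$, $[\sigma:\tau]^{\mathcal{M}}$ is the incidence number in the algebraic Morse complex of $\mathcal{M}$ with these twisted coefficients: the sum over all alternating paths $\sigma=\sigma_0\searrow\tau_1\nearrow\sigma_1\searrow\dots\tau_k\nearrow\sigma_k\searrow\tau$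 of $(-1)^k[\sigma_k:\tau]\prod_{i=1}^k[\sigma_{i-1}:\tau_i][\sigma_i:\tau_i]^{-1}$, using the twisted incidence numbers of $\mathrm{Sal}(\mathcal{A})$. Notation for codimension-$1$ faces. For a codimension-$1$ face $F$ with $\rho_{|F|}(x_0)\notin F$, $p(F)$ is the endpoint of $F$ closest to $\rho_{|F|}(x_0)$. $C(F)$ is the unique chamber containing $F$ such that $\langle C(F),F\rangle\notin N(C_0)$. When $p(F)$ is defined, $D(F)$ is the chamber opposite with respect to $p(F)$ to the chamber $C(F)^F$. For two different codimension-$1$ faces $F,G$, write $F\to G$ if (a) $p(F)$ is defined and $F\cap G=\{p(F)\}$, and (b) $|F|=|G|$, or $F$ and $C_0$ lie in the same (closed) half-plane with respect to $|G|$. In that case \[[F\to G]=\frac{[\langle D(F),p(F)\rangle:\langle C(G),G\rangle]}{[\langle D(F),p(F)\rangle:\langle C(F),F\rangle]}.\]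
   Formalization: The sign in ω(s) is (-1)^(n-1) instead of the printed (-1)^n: with Morse weight (-1)^k a sequence of n faces is a path with k=n-1 upward steps, so the printed formula is off by a global sign (it fails for the lines x=1, y=2 with base point 0). *)

(* Defs.v *)
From HB Require Import structures.
From mathcomp Require Import all_boot all_order all_algebra finmap monalg.
From mathcomp Require Import all_classical all_reals all_analysis.

Set Implicit Arguments.
Unset Strict Implicit.
Unset Printing Implicit Defensive.

Import Order.TTheory GRing.Theory Num.Theory.
Import numFieldNormedType.Exports.
Local Open Scope ring_scope.

(* The ring Z[t_v^{+-1}], v in V, built as the group ring of the free abelian *)
(* group {malg int[V]}.  The product of monalg cannot be reused: it requires  *)
(* monoids of exponents without invertible elements.                          *)

Lemma bilinear_sumA (T : nmodType) (I : Type) (m : T -> T -> T)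
    (r1 r2 r3 : seq I) (F1 F2 F3 : I -> T) :
  (forall r (F : I -> T) h, m (\sum_(i <- r) F i) h = \sum_(i <- r) m (F i) h) ->
  (forall r (F : I -> T) h, m h (\sum_(i <- r) F i) = \sum_(i <- r) m h (F i)) ->
  (forall i j k, m (F1 i) (m (F2 j) (F3 k)) = m (m (F1 i) (F2 j)) (F3 k)) ->
  m (\sum_(i <- r1) F1 i) (m (\sum_(j <- r2) F2 j) (\sum_(k <- r3) F3 k))
  = m (m (\sum_(i <- r1) F1 i) (\sum_(j <- r2) F2 j)) (\sum_(k <- r3) F3 k).
Proof.
move=> msl msr mA; rewrite !msl; apply/eq_bigr => i _.
rewrite !(msr r2) !msl; apply/eq_bigr => j _.
by rewrite !msr; apply/eq_bigr => k _.
Qed.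

Section LaurentMul.
Context {V : choiceType}.
Local Notation G := {malg int[V]}.
Local Notation L := {malg int[G]}.

Definition laurent_one : L := mkmalgU (0 : G) (1 : int).

Definition laurent_mul (g h : L) : L :=
  \sum_(k <- msupp g) \sum_(l <- msupp h) mkmalgU (k + l) (g@_k * h@_l).

Lemma laurent_mulw (d1 d2 : {fset G}) (g h : L) :
  (msupp g `<=` d1)%fset -> (msupp h `<=` d2)%fset ->
  laurent_mul g h
  = \sum_(k <- d1) \sum_(l <- d2) mkmalgU (k + l) (g@_k * h@_l).
Proof.
move=> le1 le2; rewrite /laurent_mul (big_fset_incl _ le1) /=.
  apply/eq_bigr => k _; apply/big_fset_incl => // l _ /mcoeff_outdom ->.
  by rewrite mulr0 monalgU0.
move=> k _ /mcoeff_outdom gk.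
by rewrite big1 // => l _; rewrite gk mul0r monalgU0.
Qed.

Lemma laurent_mulC : commutative laurent_mul.
Proof.
move=> g h; rewrite /laurent_mul exchange_big /=.
by apply/eq_bigr => k _; apply/eq_bigr => l _; rewrite addrC mulrC.
Qed.

Lemma laurent_mulDl : left_distributive laurent_mul +%R.
Proof.
move=> g1 g2 h; have s := fsubset_refl (msupp h).
rewrite (laurent_mulw (msuppD_le g1 g2) s).
rewrite (laurent_mulw (fsubsetUl (msupp g1) (msupp g2)) s).
rewrite (laurent_mulw (fsubsetUr (msupp g1) (msupp g2)) s).
rewrite -big_split /=; apply/eq_bigr => k _.
rewrite -big_split /=; apply/eq_bigr => l _.
by rewrite mcoeffD mulrDl monalgUD.
Qed.

Lemma laurent_mulUU (c1 c2 : int) (k1 k2 : G) :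
  laurent_mul (mkmalgU k1 c1) (mkmalgU k2 c2) = mkmalgU (k1 + k2) (c1 * c2).
Proof. by rewrite (laurent_mulw msuppU_le msuppU_le) !big_seq_fset1 !mcoeffUU. Qed.

Lemma laurent_mul0 : left_zero 0 laurent_mul.
Proof. by move=> g; rewrite /laurent_mul msupp0 big_seq_fset0. Qed.

Lemma laurent_mul_suml (I : Type) (r : seq I) (F : I -> L) (h : L) :
  laurent_mul (\sum_(i <- r) F i) h = \sum_(i <- r) laurent_mul (F i) h.
Proof.
exact: (big_morph (laurent_mul^~ h) (fun _ _ => laurent_mulDl _ _ _)
          (laurent_mul0 h)).
Qed.

Lemma laurent_mul_sumr (I : Type) (r : seq I) (F : I -> L) (h : L) :
  laurent_mul h (\sum_(i <- r) F i) = \sum_(i <- r) laurent_mul h (F i).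
Proof.
by rewrite laurent_mulC laurent_mul_suml; apply/eq_bigr => i _; rewrite laurent_mulC.
Qed.

Lemma laurent_sumP (g : L) : exists sc : seq G * (G -> int),
  g = \sum_(k <- sc.1) mkmalgU k (sc.2 k).
Proof. by exists (msupp g : seq G, mcoeff^~ g); exact: monalgE. Qed.

Lemma laurent_mulA : associative laurent_mul.
Proof.
move=> g1 g2 g3.
have [[s1 c1] ->] := laurent_sumP g1; have [[s2 c2] ->] := laurent_sumP g2.
have [[s3 c3] ->] := laurent_sumP g3.
apply: bilinear_sumA; [exact: laurent_mul_suml|exact: laurent_mul_sumr|].
move=> k1 k2 k3; move: (@mkmalgU _ _) laurent_mul laurent_mulUU => U m mUU.
by rewrite !mUU mulrA addrA.
Qed.

Lemma laurent_mul1 : left_id laurent_one laurent_mul.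
Proof.
move: laurent_mul laurent_mulUU laurent_mul_sumr => m mUU msr g.
rewrite {1}(monalgE g) msr [RHS]monalgE.
by apply/eq_bigr => k _; rewrite mUU mul1r add0r.
Qed.

Lemma laurent_one_neq0 : laurent_one != 0.
Proof. by rewrite monalgU_eq0. Qed.

End LaurentMul.

Definition laurent (V : choiceType) : Type := {malg int[{malg int[V]}]}.

Section LaurentRing.
Context {V : choiceType}.
Local Notation L := (laurent V).

HB.instance Definition _ := GRing.Zmodule.on L.
HB.instance Definition _ := GRing.Zmodule_isComNzRing.Build L
  (@laurent_mulA V) (@laurent_mulC V) (@laurent_mul1 V) (@laurent_mulDl V)
  (@laurent_one_neq0 V).

Definition laurent_unit : {pred L} := fun x => `[< exists y : L, y * x = 1 >].

Definition laurent_inv (x : L) : L :=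
  if pselect (exists y : L, y * x = 1) is left h then projT1 (cid h) else x.

Fact laurent_mulV : {in laurent_unit, left_inverse 1 laurent_inv *%R}.
Proof.
move=> x /asboolP ux; rewrite /laurent_inv; case: pselect => // h.
by case: (cid h).
Qed.

Fact laurent_unitPl (x y : L) : y * x = 1 -> laurent_unit x.
Proof. by move=> yx1; apply/asboolP; exists y. Qed.

Fact laurent_inv_out : {in [predC laurent_unit], laurent_inv =1 id}.
Proof.
move=> x; rewrite inE => /negP nu; rewrite /laurent_inv.
by case: pselect => // h; case: nu; apply/asboolP.
Qed.

HB.instance Definition _ := GRing.ComNzRing_hasMulInverse.Build L
  laurent_mulV laurent_unitPl laurent_inv_out.

Definition laurent_var (v : V) : L := mkmalgU (mkmalgU v (1 : int)) (1 : int).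

Lemma laurent_var_unit (v : V) : laurent_var v \is a GRing.unit.
Proof.
apply/asboolP; exists (mkmalgU (mkmalgU v (-1)) 1).
by rewrite [LHS]laurent_mulUU -raddfD /= addNr raddf0 mulr1.
Qed.

End LaurentRing.

Local Open Scope classical_set_scope.

Section Plane.
Context {R : realType}.
Local Notation pt := (R * R)%type.
Implicit Types (l K S : set pt) (x y : pt).

(* R * R carries the maximum norm in the library; its topology is the usual   *)
(* one, but the metric has to be defined.                                     *)
Definition dist x y : R := Num.sqrt ((x.1 - y.1) ^+ 2 + (x.2 - y.2) ^+ 2).

Definition dist_set x K : R := inf [set dist x y | y in K].

Definition proj K x : pt :=
  xget x [set y | K y /\ forall z, K z -> dist x y <= dist x z].

Definition line_eq (a b c : R) l : Prop :=
  (a != 0 \/ b != 0) /\ l = [set x : pt | a * x.1 + b * x.2 = c].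

Definition is_line l : Prop := exists a b c, line_eq a b c l.

Definition same_side l x y : Prop := exists a b c, line_eq a b c l /\
  0 < (a * x.1 + b * x.2 - c) * (a * y.1 + b * y.2 - c).

Definition opposite_sides l x y : Prop := exists a b c, line_eq a b c l /\
  (a * x.1 + b * x.2 - c) * (a * y.1 + b * y.2 - c) < 0.

Definition same_closed_half_plane l K K' : Prop := exists a b c,
  line_eq a b c l /\ K `|` K' `<=` [set x | c <= a * x.1 + b * x.2].

Definition affine_closed S : Prop := forall x y (t : R), S x -> S y ->
  S (x.1 + t * (y.1 - x.1), x.2 + t * (y.2 - x.2)).

Definition affine_span K : set pt := smallest affine_closed K.

Definition codim K (k : nat) : Prop :=
  match k with
  | 0 => affine_span K = setT
  | 1 => is_line (affine_span K)
  | 2 => exists p, affine_span K = [set p]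
  | _ => False
  end.

End Plane.

Section Arrangement.
Context {R : realType}.
Local Notation pt := (R * R)%type.
Context (A : set (set pt)).
Implicit Types (C D E F G L l : set pt) (x y p : pt).

Definition arrangement : Prop :=
  (forall l, A l -> is_line l) /\
  forall x, exists U, nbhs x U /\ finite_set [set l | A l /\ l `&` U !=set0].

Definition same_stratum x y : Prop :=
  forall l, A l -> (l x /\ l y) \/ same_side l x y.

Definition face F : Prop := exists x, F = closure [set y | same_stratum x y].

Definition chamber C : Prop := face C /\ codim C 0.

Definition edge F : Prop := face F /\ codim F 1.

Definition wall C l : Prop := A l /\ edge (C `&` l).

Definition sep C C' : set (set pt) :=
  [set l | A l /\ exists x y, [/\ C x, C' y & opposite_sides l x y]].

Definition supp F : set (set pt) := [set l | A l /\ F `<=` l].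

(* C.F and C^F *)
Definition dot C F : set pt :=
  xget set0 [set C' | [/\ chamber C', F `<=` C' & supp F `&` sep C C' = set0]].

Definition opp C F : set pt :=
  xget set0 [set C' | [/\ chamber C', F `<=` C' & sep C C' = supp F]].

Definition flat L : Prop := L !=set0 /\
  exists2 B : set (set pt), B `<=` A & L = \bigcap_(l in B) l.

Definition generic x : Prop :=
  (forall C C', chamber C -> chamber C' -> dist_set x C = dist_set x C' ->
     proj C x = proj C' x /\ (C `&` C') (proj C x)) /\
  (forall L L', flat L -> flat L' -> L' `<` L -> dist_set x L < dist_set x L').

Definition base_chamber x : set pt := xget set0 [set C | chamber C /\ C x].

(* The pair (C, F) stands for the cell <C,F>. *)
Local Notation cell := (set pt * set pt)%type.
Implicit Types (s t u : cell).

Definition sal s : Prop := [/\ chamber s.1, face s.2 & s.2 `<=` s.1].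

Definition cell_dim s (k : nat) : Prop := codim s.2 k.

Definition sal_lt s t : Prop :=
  [/\ sal s, sal t, t.2 `<` s.2 & dot t.1 s.2 = s.1].

Definition covers s t : Prop :=
  sal_lt t s /\ ~ exists u, sal_lt t u /\ sal_lt u s.

Definition Sset C : set cell := [set s | sal s /\ s.1 = dot C s.2].

(* A total order in which each element has finitely many predecessors is      *)
(* finite or of the order type of the natural numbers.                        *)
Definition chamber_order (prec : set pt -> set pt -> Prop) : Prop :=
  [/\ forall C, chamber C -> ~ prec C C,
      forall C C' C'', chamber C -> chamber C' -> chamber C'' ->
        prec C C' -> prec C' C'' -> prec C C'',
      forall C C', chamber C -> chamber C' -> C <> C' -> prec C C' \/ prec C' C
    & forall C, chamber C -> finite_set [set C' | chamber C' /\ prec C' C]].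

Definition Nset (prec : set pt -> set pt -> Prop) C : set cell :=
  [set s | Sset C s /\ forall C', chamber C' -> prec C' C -> ~ Sset C' s].

Definition euclidean_order x (prec : set pt -> set pt -> Prop) : Prop :=
  [/\ generic x, chamber_order prec
    & forall C C', chamber C -> chamber C' -> prec C C' ->
        dist_set x C <= dist_set x C'].

Definition eta (prec : set pt -> set pt -> Prop) s : cell :=
  (xget set0 [set C | chamber C /\ Nset prec C s], opp s.1 s.2).

(* A matching is a set of edges (s, t) of the Hasse diagram, with t < s. *)

Definition matching (M : set (cell * cell)) : Prop :=
  (forall s t, M (s, t) -> covers s t) /\
  (forall u e e', M e -> M e' -> u = e.1 \/ u = e.2 -> u = e'.1 \/ u = e'.2 ->
     e = e').

Definition down (M : set (cell * cell)) s t : Prop := covers s t /\ ~ M (s, t).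

Definition arrow (M : set (cell * cell)) : rel cell :=
  fun s t => `[< down M s t \/ M (t, s) >].

Definition acyclic (M : set (cell * cell)) : Prop :=
  forall c : seq cell, cycle (arrow M) c -> c = [::].

Definition critical (M : set (cell * cell)) s : Prop :=
  sal s /\ forall e, M e -> s <> e.1 /\ s <> e.2.

Definition smallest_face C x F : Prop :=
  [/\ face F, F `<=` C, F x
    & forall G, face G -> G `<=` C -> G x -> F `<=` G].

Definition euclidean_matching x (M : set (cell * cell)) : Prop :=
  [/\ matching M, acyclic M, generic x,
      exists2 prec, euclidean_order x prec
        & forall s t, M (s, t) -> eta prec s = eta prec t
    & forall s, critical M s <->
        chamber s.1 /\ smallest_face s.1 (proj s.1 x) s.2].

(* The integral incidence numbers of a regular CW complex are determined by   *)
(* the orientations of the cells and the properties below; conversely every   *)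
(* function with these properties comes from a choice of orientations of the  *)
(* cells of positive dimension.                                               *)
Definition incidence (inc : cell -> cell -> int) : Prop :=
  let facet t s := sal_lt t s /\ exists k, cell_dim s k.+1 /\ cell_dim t k in
  [/\ forall s t, facet t s -> inc s t = 1 \/ inc s t = -1,
      forall s t, ~ facet t s -> inc s t = 0,
      forall s, sal s -> cell_dim s 1 ->
        \sum_(t \in [set t | sal_lt t s]) inc s t = 0
    & forall s u, sal s -> sal u -> cell_dim s 2 -> cell_dim u 0 ->
        \sum_(t \in [set t | sal_lt u t /\ sal_lt t s]) inc s t * inc t u = 0].

Definition orienting_wall x D p l : Prop :=
  let C0 := base_chamber x in
  [/\ wall D l, l p
    & ~ sep D C0 l \/
      forall l', wall D l' -> l' p ->
        sep D C0 l' /\ dist_set x l <= dist_set x l'].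

Definition oriented x (prec : set pt -> set pt -> Prop)
    (inc : cell -> cell -> int) : Prop :=
  (forall C F, sal (C, F) -> cell_dim (C, F) 1 ->
     inc (C, F) (opp C F, opp C F) = 1) /\
  (forall D p l, sal (D, [set p]) -> ~ Nset prec (base_chamber x) (D, [set p]) ->
     orienting_wall x D p l -> inc (D, [set p]) (D, D `&` l) = 1).

Definition ubar x D C : laurent A :=
  let C0 := base_chamber x in
  \big[*%R/1]_(l \in [set l : A | (sep C0 C `&` sep D C) (val l)])
    laurent_var l.

Definition tinc x (inc : cell -> cell -> int) s t : laurent A :=
  (inc s t)%:~R * ubar x (opp s.1 s.2) (opp t.1 t.2).

(* The sequence [:: (t_1, s_1); ..; (t_k, s_k)] encodes the alternating path  *)
(* s \ t_1 / s_1 \ .. \ t_k / s_k \ t.                                        *)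
Fixpoint alternating (M : set (cell * cell)) s (c : seq (cell * cell)) t
    : Prop :=
  match c with
  | [::] => down M s t
  | e :: c' => [/\ down M s e.1, M (e.2, e.1) & alternating M e.2 c' t]
  end.

Definition alternating_paths (M : set (cell * cell)) s t
    : set (seq (cell * cell)) :=
  [set c | alternating M s c t].

Definition path_weight x (inc : cell -> cell -> int) s t
    (c : seq (cell * cell)) : laurent A :=
  let k := size c in
  let sigma i := nth s (s :: unzip2 c) i in
  let tau i := nth s (s :: unzip1 c) i in
  (-1) ^+ k * tinc x inc (sigma k) t *
  \prod_(1 <= i < k.+1)
    (tinc x inc (sigma i.-1) (tau i) * (tinc x inc (sigma i) (tau i))^-1).

Definition morse_inc (M : set (cell * cell)) x (inc : cell -> cell -> int) s t
    : laurent A :=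
  \sum_(c \in alternating_paths M s t) path_weight x inc s t c.

Definition p_defined x F : Prop := ~ F (proj (affine_span F) x).

Definition p_of x F : pt :=
  let rho := proj (affine_span F) x in
  let endpoint q := face [set q] /\ F q in
  xget rho [set p | endpoint p /\
                    forall q, endpoint q -> dist rho p <= dist rho q].

Definition C_of (prec : set pt -> set pt -> Prop) x F : set pt :=
  xget set0 [set C | [/\ chamber C, F `<=` C
                       & ~ Nset prec (base_chamber x) (C, F)]].

Definition D_of (prec : set pt -> set pt -> Prop) x F : set pt :=
  opp (opp (C_of prec x F) F) [set p_of x F].

Definition edge_to x : rel (set pt) := fun F G =>
  `[< [/\ F <> G, p_defined x F, F `&` G = [set p_of x F]
        & affine_span F = affine_span G \/
          same_closed_half_plane (affine_span G) F (base_chamber x)] >].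

Definition edge_weight (prec : set pt -> set pt -> Prop) x
    (inc : cell -> cell -> int) F G : laurent A :=
  let s := (D_of prec x F, [set p_of x F]) in
  tinc x inc s (C_of prec x G, G) / tinc x inc s (C_of prec x F, F).

(* The set Seq for the 2-cell s and the edge F. *)
Definition edge_seqs (prec : set pt -> set pt -> Prop) x s F
    : set (seq (set pt)) :=
  [set q | [/\ q != [::], forall G, G \in q -> edge G, sorted (edge_to x) q,
               last F q = F
             & sal_lt (C_of prec x (head F q), head F q) s]].

(* The exponent of -1 is the number k = n - 1 of upward steps of the          *)
(* corresponding alternating path, where n = size q.  In particular, q = [:: F] *)
(* corresponds to the path s \ (C, F), whose weight is tinc x inc s (C, F).   *)
Definition seq_weight (prec : set pt -> set pt -> Prop) x
    (inc : cell -> cell -> int) s F (q : seq (set pt)) : laurent A :=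
  let F1 := head F q in
  (-1) ^+ (size q).-1 * tinc x inc s (C_of prec x F1, F1) *
  \prod_(i < (size q).-1) edge_weight prec x inc (nth F q i) (nth F q i.+1).

End Arrangement.

(* Main.v *)
Require Import Defs.
From mathcomp Require Import all_boot all_order all_algebra.
From mathcomp Require Import all_classical all_reals all_analysis.
From mathcomp Require Import ring lra.

(* An alternating path from a critical 2-cell to a critical 1-cell never enters
   N(C_0) = S(C_0): this is a subcomplex, a union of matched pairs and of
   <C_0,C_0>, so a path cannot leave it, and it contains no critical 1-cell.
   The 1-cells met by the path are hence of the form <C(F),F>.  Such a cell lies
   in N(C) for the chamber C beyond |F| that contains the projection r of x_0 on
   |F|.  It is critical if r is in F; otherwise it is matched with a 2-cell
   <D,q> in the same N(C), so D = C.q, which forces q to lie between r and F: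
   then q = p(F) and D = D(F).  A path is therefore determined by its edges F_i,
   and <C(G),G> < <D(F),p(F)> with G <> F amounts to F -> G.

   The distance from x_0 to p(F_i) does not increase along the sequence, and no
   F_i is repeated since the matching is acyclic; local finiteness then bounds
   the number of sequences. *)

Set Implicit Arguments.
Unset Strict Implicit.
Unset Printing Implicit Defensive.

Import Order.TTheory GRing.Theory Num.Theory.
Import numFieldNormedType.Exports.
Local Open Scope ring_scope.
Local Open Scope classical_set_scope.

(** * Signs and lines *)

(** Every face is handled through a point [z] of its relative interior, which turns separation, C.F
    and C^F into comparisons of signs on the lines.

    The position of the vertex q matched with F comes from the two components of [eta]. The first
    gives D = C.q, so on a line m other than |F| through q the chamber D has the sign of r. The
    second gives D^q = C(F)^F, so on m the chamber D has the sign opposite to that of F. Thus m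
    separates r from F, and q lies between them.

    Genericity enters twice. Condition (ii) keeps every line other than |F| away from r, so r is
    interior to an edge and exactly one chamber beyond |F| contains it. Condition (i) forces a
    chamber at the same distance as that one to contain r as well, so no chamber beyond |F| can
    precede it.

    The Euclidean order that witnesses the matching may differ from [prec]. The two are compared
    through N(C_0), which is S(C_0) for both, and through the chamber beyond |F| at r, which is
    found from [x0] alone. *)

Section Signs.
Context {R : realDomainType}.
Implicit Types u v d t : R.

Lemma sgr_eqP u v : Num.sg u = Num.sg v <->
  [\/ 0 < u /\ 0 < v, u < 0 /\ v < 0 | u = 0 /\ v = 0].
Proof.
split; last first.
  by case=> -[] => [/gtr0_sg -> /gtr0_sg ->|/ltr0_sg -> /ltr0_sg ->|-> ->].
have n1 : (1 : R) != -1 by apply/eqP; lra.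
by case: (sgrP u); case: (sgrP v) => //; try (by constructor);
  move=> ? ? /eqP; rewrite ?oppr_eq0 ?oner_eq0 ?(negbTE n1) // eq_sym
    ?oppr_eq0 ?oner_eq0 ?(negbTE n1).
Qed.

Lemma sgr_eqNP u v : Num.sg u = - Num.sg v <->
  [\/ 0 < u /\ v < 0, u < 0 /\ 0 < v | u = 0 /\ v = 0].
Proof.
rewrite -sgrN sgr_eqP oppr_gt0 oppr_lt0.
split; case=> -[H1 H2]; [by constructor 1|by constructor 2| |
  by constructor 1|by constructor 2|]; constructor 3; split=> //; last lra.
by apply/eqP; rewrite -oppr_eq0 H2.
Qed.

Lemma sgr0P u : Num.sg u = 0 <-> u = 0.
Proof. by split=> [/eqP|->]; [rewrite sgr_eq0 => /eqP|rewrite sgr0]. Qed.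

Lemma sgr_trichotomy u v : u != 0 -> v != 0 ->
  Num.sg u = Num.sg v \/ Num.sg u = - Num.sg v.
Proof.
rewrite sgr_eqP sgr_eqNP => u0 v0.
have [uneg|upos|ue] := ltrgtP u 0; have [vneg|vpos|ve] := ltrgtP v 0;
  rewrite ?ue ?ve ?eqxx // in u0 v0; by [left; constructor|right; constructor].
Qed.

Lemma sgr_perturb u d : `|d| < `|u| -> Num.sg (u + d) = Num.sg u.
Proof.
rewrite ltr_norml => /andP[h1 h2]; apply/sgr_eqP.
have [u0|u0] := ltrP u 0; first by rewrite ltr0_norm // in h1 h2; constructor 2; lra.
by rewrite ger0_norm // in h1 h2; constructor 1; lra.
Qed.

Lemma sgrMgt0 u v : 0 < u * v -> u != 0 /\ Num.sg v = Num.sg u.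
Proof.
move=> uv; split; first by apply/eqP => u0; rewrite u0 mul0r ltxx in uv.
apply/sgr_eqP; have [u0|u0|u0] := ltrgtP u 0; last by rewrite u0 mul0r ltxx in uv.
  by rewrite nmulr_rgt0 // in uv; constructor 2.
by rewrite pmulr_rgt0 // in uv; constructor 1.
Qed.

Lemma sgrMlt0 u v : u * v < 0 -> u != 0 /\ Num.sg v = - Num.sg u.
Proof.
rewrite -oppr_gt0 -mulrN => /sgrMgt0[? h]; split=> //.
by rewrite -h sgrN opprK.
Qed.

Lemma sgr_eq_gt0 u v : u != 0 -> Num.sg v = Num.sg u -> 0 < u * v.
Proof.
move=> u0 /sgr_eqP[[a b]|[a b]|[_ b]]; [by rewrite mulr_gt0|by rewrite nmulr_rgt0|].
by rewrite b eqxx in u0.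
Qed.

Lemma sgr_neq_oppr u : u != 0 -> Num.sg u <> - Num.sg u.
Proof. by move=> /eqP u0 /sgr_eqNP[[] | [] | []] //; lra. Qed.

End Signs.

Section Lines.
Context {R : realType}.
Local Notation pt := (R * R)%type.
Implicit Types (l m K S : set pt) (x y z v w : pt) (t : R).

(* The equation of a line is an arbitrary choice: only comparisons between the
   signs of two points are used. *)
Definition coef l : R * R * R :=
  xget (0, 0, 0) [set k | line_eq k.1.1 k.1.2 k.2 l].

Definition ev l x : R :=
  (coef l).1.1 * x.1 + (coef l).1.2 * x.2 - (coef l).2.

Definition sg l x : R := Num.sg (ev l x).

Definition along x y t : pt := (x.1 + t * (y.1 - x.1), x.2 + t * (y.2 - x.2)).

Lemma along0 x y : along x y 0 = x.
Proof. by rewrite /along !mul0r !addr0; case: x. Qed.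

Lemma along1 x y : along x y 1 = y.
Proof. by rewrite /along !mul1r !(addrC _ (_ - _)) !subrK; case: y. Qed.

Lemma along_alongV x y t : t != 0 -> along x (along x y t) t^-1 = y.
Proof. by move=> t0; case: y => y1 y2; rewrite /along /=; congr (_, _); field. Qed.

Lemma ev_along l x y t : ev l (along x y t) = ev l x + t * (ev l y - ev l x).
Proof. by rewrite /ev /along /=; ring. Qed.

Lemma ev_along0 l x y t : ev l x = 0 -> ev l (along x y t) = t * ev l y.
Proof. by rewrite ev_along => ->; rewrite add0r subr0. Qed.

Lemma is_line_coef l : is_line l -> line_eq (coef l).1.1 (coef l).1.2 (coef l).2 l.
Proof.
move=> [a [b [c h]]].
by have := @xgetI _ (0, 0, 0) [set k : R * R * R | line_eq k.1.1 k.1.2 k.2 l] (a, b, c) h.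
Qed.

Lemma sqr_norm_gt0 (a b : R) : a != 0 \/ b != 0 -> 0 < a ^+ 2 + b ^+ 2.
Proof.
have h0 (c : R) : 0 <= c ^+ 2 := sqr_ge0 c.
by case=> h; [apply: ltr_pwDl|apply: ltr_wpDl] => //;
  rewrite exprn_even_gt0.
Qed.

Lemma lineE l x : is_line l -> l x <-> ev l x = 0.
Proof.
move=> /is_line_coef[_ le]; rewrite /ev; case: (coef l) le => -[a b] c /= le.
by rewrite {1}le /=; split=> h; lra.
Qed.

(** Makes the comparison of signs independent of the equation that [coef] happens to choose. *)
Lemma line_eq_ev (a b c : R) l : line_eq a b c l ->
  exists2 k, k != 0 & forall x, a * x.1 + b * x.2 - c = k * ev l x.
Proof.
move=> h; have il : is_line l by exists a, b, c.
have [nz le] := is_line_coef il; have [nz' le'] := h.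
rewrite /ev; case: (coef l) nz le => -[a' b'] c' /= nz le.
have s0 := sqr_norm_gt0 nz; have sn0 : a' ^+ 2 + b' ^+ 2 != 0 by rewrite gt_eqF.
set s := a' ^+ 2 + b' ^+ 2 in s0 sn0.
(* [u] is the foot of the origin on [l] and [u'] its translate along the direction of [l].
   Substituting both in the other equation makes the normals parallel. *)
pose u : pt := (c' * a' / s, c' * b' / s).
pose u' : pt := (u.1 - b', u.2 + a').
have lu : l u by rewrite le /= /s; field.
have lu' : l u' by rewrite le /= /s; field.
rewrite le' /= in lu lu'.
have ab : a * b' = b * a' by lra.
have ka : a = (a * a' + b * b') / s * a'.
  have -> : (a * a' + b * b') / s * a' = (a * a' ^+ 2 + (b * a') * b') / s by field.
  by rewrite -ab /s; field.
have kb : b = (a * a' + b * b') / s * b'.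
  have -> : (a * a' + b * b') / s * b' = ((a * b') * a' + b * b' ^+ 2) / s by field.
  by rewrite ab /s; field.
have kc : c = (a * a' + b * b') / s * c' by rewrite -lu; field.
move: ka kb kc; set k := (_ / s) => ka kb kc.
exists k; last by move=> x; rewrite ka kb kc; ring.
apply/eqP => k0; rewrite k0 !mul0r in ka kb.
by case: nz'; rewrite ?ka ?kb eqxx.
Qed.

Lemma same_sideE l x y : is_line l ->
  same_side l x y <-> ev l x != 0 /\ sg l y = sg l x.
Proof.
move=> il; split.
  move=> [a [b [c [h]]]]; have [k k0 kE] := line_eq_ev h.
  rewrite !kE mulrACA pmulr_rgt0; first exact: sgrMgt0.
  by rewrite -expr2 exprn_even_gt0.
move=> [x0 xy]; exists (coef l).1.1, (coef l).1.2, (coef l).2.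
by split; [exact: is_line_coef|exact: sgr_eq_gt0].
Qed.

Lemma opposite_sidesE l x y : is_line l ->
  opposite_sides l x y <-> ev l x != 0 /\ sg l y = - sg l x.
Proof.
move=> il; split.
  move=> [a [b [c [h]]]]; have [k k0 kE] := line_eq_ev h.
  rewrite !kE mulrACA pmulr_rlt0; first exact: sgrMlt0.
  by rewrite -expr2 exprn_even_gt0.
move=> [x0 xy]; exists (coef l).1.1, (coef l).1.2, (coef l).2.
split; first exact: is_line_coef.
rewrite -oppr_gt0 -mulrN; apply: sgr_eq_gt0 => //.
by rewrite sgrN -/(sg l y) xy opprK.
Qed.

Lemma same_closed_half_planeE l K K' x y : is_line l ->
    (forall z, K z -> sg l z = 0 \/ sg l z = sg l x) -> K x ->
    (forall z, K' z -> sg l z = 0 \/ sg l z = sg l y) -> K' y ->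
    ev l x != 0 -> ev l y != 0 ->
  same_closed_half_plane l K K' <-> sg l x = sg l y.
Proof.
move=> il Kx xK Ky yK x0 y0; split.
  move=> [a [b [c [h hs]]]]; have [k k0 kE] := line_eq_ev h.
  have hx : 0 <= k * ev l x by rewrite -kE subr_ge0; apply: hs; left.
  have hy : 0 <= k * ev l y by rewrite -kE subr_ge0; apply: hs; right.
  have /sgrMgt0[_ sx] : 0 < k * ev l x by rewrite lt0r hx mulf_neq0.
  have /sgrMgt0[_ sy] : 0 < k * ev l y by rewrite lt0r hy mulf_neq0.
  by rewrite /sg sx sy.
move=> sxy; have [nz le] := is_line_coef il.
(* The half-plane is required in the form [c <= ...]. Multiplying the equation by the sign [k] turns
   the side of [x] into that one. *)
pose k := sg l x; have k0 : k != 0 by rewrite sgr_eq0.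
exists (k * (coef l).1.1), (k * (coef l).1.2), (k * (coef l).2).
split.
  split; first by case: nz => nz; [left|right]; rewrite mulf_neq0.
  rewrite {1}le; apply/seteqP; split=> z /=; rewrite -!mulrA -mulrDr; first by move=> ->.
  exact: mulfI.
move=> z /= zK; rewrite -!mulrA -mulrDr -subr_ge0 -mulrBr -/(ev l z).
have : sg l z = 0 \/ sg l z = k.
  by case: zK => [/Kx|/Ky] //; rewrite -sxy.
case=> [/sgr0P ->|zk]; first by rewrite mulr0.
apply/ltW/sgr_eq_gt0 => //; first by rewrite /k /sg sgr_id.
Qed.

Lemma line_along l x y t : is_line l -> l x -> l y -> l (along x y t).
Proof.
move=> il /(lineE _ il) lx /(lineE _ il) ly; apply/(lineE _ il).
by rewrite ev_along lx ly subrr mulr0 addr0.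
Qed.

Lemma line_two_points l : is_line l -> forall x, l x -> exists2 y, l y & y <> x.
Proof.
move=> il x lx; have [nz le] := is_line_coef il.
exists (x.1 - (coef l).1.2, x.2 + (coef l).1.1).
  by apply/(lineE _ il); move/(lineE _ il): lx; rewrite /ev /= => lx; rewrite -lx; ring.
case: x {lx} => x1 x2 [/eqP h1 /eqP h2]; case: nz => /negP; apply.
  by rewrite -(inj_eq (addrI x2)) addr0.
by rewrite -oppr_eq0 -(inj_eq (addrI x1)) addr0.
Qed.

Lemma line_sub_eq l m x y : is_line l -> is_line m -> x <> y ->
  l x -> l y -> m x -> m y -> l = m.
Proof.
move=> il im xy lx ly mx my.
have [nz le] := is_line_coef il; have [nz' le'] := is_line_coef im.
have key (a b c a' b' c' : R) : a != 0 \/ b != 0 -> a' != 0 \/ b' != 0 ->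
    a * x.1 + b * x.2 = c -> a * y.1 + b * y.2 = c ->
    a' * x.1 + b' * x.2 = c' -> a' * y.1 + b' * y.2 = c' ->
    forall z : pt, a * z.1 + b * z.2 = c -> a' * z.1 + b' * z.2 = c'.
  move=> n n' h1 h2 h3 h4 z h5.
  have d0 : (y.1 - x.1) ^+ 2 + (y.2 - x.2) ^+ 2 != 0.
    rewrite gt_eqF // sqr_norm_gt0 // !subr_eq0.
    have [e1|n1] := eqVneq y.1 x.1; last by left.
    have [e2|n2] := eqVneq y.2 x.2; last by right.
    by case: xy; case: (x) (y) e1 e2 => ? ? [? ?] /= -> ->.
  have e1 : a * (y.1 - x.1) = - b * (y.2 - x.2) by lra.
  have e2 : a' * (y.1 - x.1) = - b' * (y.2 - x.2) by lra.
  (* The determinant of the two normals is killed by both coordinates of [y - x], hence by its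
     nonzero squared length. *)
  have ab : a * b' = b * a'.
    have h : (a * b' - b * a') * (y.1 - x.1) = 0.
      have -> : (a * b' - b * a') * (y.1 - x.1) =
        b' * (a * (y.1 - x.1)) - b * (a' * (y.1 - x.1)) by ring.
      by rewrite e1 e2; ring.
    have h' : (a * b' - b * a') * (y.2 - x.2) = 0.
      have -> : (a * b' - b * a') * (y.2 - x.2) =
        - a * (- b' * (y.2 - x.2)) + a' * (- b * (y.2 - x.2)) by ring.
      by rewrite -e1 -e2; ring.
    have : (a * b' - b * a') * ((y.1 - x.1) ^+ 2 + (y.2 - x.2) ^+ 2) = 0.
      by rewrite mulrDr !expr2 !mulrA h h' !mul0r addr0.
    by move=> /eqP; rewrite mulf_eq0 (negbTE d0) orbF subr_eq0 => /eqP.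
  rewrite -h3; have h6 : a * (z.1 - x.1) + b * (z.2 - x.2) = 0 by lra.
  have h7 : a' * (a * (z.1 - x.1) + b * (z.2 - x.2)) =
            a * (a' * (z.1 - x.1) + b' * (z.2 - x.2)).
    have -> : forall u v : R, a' * (a * u + b * v) = a * (a' * u) + (b * a') * v.
      by move=> u v; ring.
    by rewrite -ab; ring.
  have h8 : b' * (a * (z.1 - x.1) + b * (z.2 - x.2)) =
            b * (a' * (z.1 - x.1) + b' * (z.2 - x.2)).
    have -> : forall u v : R, b' * (a * u + b * v) = (a * b') * u + b * (b' * v).
      by move=> u v; ring.
    by rewrite ab; ring.
  rewrite h6 mulr0 in h7 h8.
  suff : a' * (z.1 - x.1) + b' * (z.2 - x.2) = 0 by lra.
  by case: n => nn; apply: (mulfI nn); rewrite mulr0 -?h7 -?h8 ?mulr0.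
have ptE k (ik : is_line k) z : k z <->
    (coef k).1.1 * z.1 + (coef k).1.2 * z.2 = (coef k).2.
  by rewrite (lineE _ ik) /ev; split=> h; lra.
move: lx ly mx my => /(ptE _ il) lx /(ptE _ il) ly /(ptE _ im) mx /(ptE _ im) my.
apply/seteqP; split=> z.
  by move=> /(ptE _ il) hz; apply/(ptE _ im); apply: (key _ _ _ _ _ _ nz nz' lx ly mx my z hz).
by move=> /(ptE _ im) hz; apply/(ptE _ il); apply: (key _ _ _ _ _ _ nz' nz mx my lx ly z hz).
Qed.

End Lines.

(** * Faces as sign vectors *)

Section Faces.
Context {R : realType}.
Local Notation pt := (R * R)%type.
Implicit Types (l m K S : set pt) (x y z v w : pt) (t : R).

Lemma ev_near l x : ev l x != 0 -> \forall y \near x, sg l y = sg l x.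
Proof.
move=> x0; have ce : ev l y @[y --> x] --> ev l x.
  apply: cvgB; last exact: cvg_cst.
  by apply: cvgD; apply: cvgM; [exact: cvg_cst|exact: cvg_fst|exact: cvg_cst|exact: cvg_snd].
have e0 : 0 < `|ev l x| by rewrite normr_gt0.
have ne := cvgr_distC_lt _ _ ce _ e0.
near=> y; have -> : sg l y = Num.sg (ev l x + (ev l y - ev l x)) by rewrite addrC subrK.
apply: sgr_perturb; near: y; exact: ne.
Unshelve. all: by end_near. Qed.

Lemma nbhs_along x v (U : set pt) : nbhs x U ->
  exists2 d, 0 < d <= 1 & forall t, 0 <= t <= d -> U (along x v t).
Proof.
move=> /nbhs_ballP[e /= e0 sU].
pose n := `|v.1 - x.1| + `|v.2 - x.2|.
have n0 : 0 <= n by rewrite addr_ge0.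
have en : 0 < e + n by rewrite ltr_pwDl.
(* Unlike [e / n], this is at most 1 and makes sense when [v = x]. *)
exists (e / (e + n)).
  by rewrite divr_gt0 // ler_pdivrMr // mul1r lerDl.
move=> t /andP[t0 td]; apply: sU.
have h u : `|u| <= n -> `|t * u| < e.
  move=> un; rewrite normrM ger0_norm //.
  apply: (le_lt_trans (ler_wpM2l t0 un)).
  apply: (le_lt_trans (ler_wpM2r n0 td)).
  rewrite mulrAC ltr_pdivrMr // ltr_pM2l //; lra.
split; rewrite /ball /= opprD addrA subrr add0r normrN; apply: h;
  by rewrite /n ?lerDl ?lerDr.
Qed.

Lemma along_sg l x y t : 0 < t <= 1 -> sg l x = 0 \/ sg l x = sg l y ->
  sg l (along x y t) = sg l y.
Proof.
move=> /andP[t0 t1]; rewrite /sg ev_along => -[/sgr0P ->|/sgr_eqP h].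
  by rewrite subr0 add0r sgrM gtr0_sg // mul1r.
set u := ev l x in h *; set u' := ev l y in h *; apply/sgr_eqP.
have -> : u + t * (u' - u) = (1 - t) * u + t * u' by ring.
have t1' : 0 <= 1 - t by rewrite subr_ge0.
case: h => -[h1 h2]; [constructor 1|constructor 2|constructor 3]; split=> //.
- by rewrite ltr_wpDl ?mulr_ge0 ?mulr_gt0 // ltW.
- by rewrite ltr_wnDl ?mulr_ge0_le0 ?pmulr_rlt0 // ltW.
- by rewrite h1 h2 !mulr0 addr0.
Qed.

Lemma sg_along_const l x v d : (forall t, 0 <= t <= d -> ev l (along x v t) != 0) ->
  forall t, 0 <= t <= d -> sg l (along x v t) = sg l x.
Proof.
move=> nz t /andP[t0 td].
have x0 : ev l x != 0 by rewrite -(along0 x v); apply: nz; rewrite lexx (le_trans t0).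
have xt : ev l (along x v t) != 0 by apply: nz; rewrite t0.
have [//|] := sgr_trichotomy xt x0.
set u := ev l (along x v t) in xt *; set u0 := ev l x in x0 * => h.
(* An explicit intermediate value: an affine function equal to [u0] at time 0 and to [u] at time [t]
   vanishes at time [u0 / (u0 - u) * t]. *)
have du : 0 < u0 / (u0 - u) < 1.
  case/sgr_eqNP: h => -[h1 h2].
  - have h3 : u0 - u < 0 by lra.
    by apply/andP; split; [rewrite nmulr_rgt0 ?invr_lt0|rewrite ltr_ndivrMr // mul1r; lra].
  - have h3 : 0 < u0 - u by lra.
    by apply/andP; split; [rewrite divr_gt0|rewrite ltr_pdivrMr // mul1r; lra].
  - by rewrite h2 eqxx in x0.
have /andP[d0 d1] := du.
have u0u : u0 - u != 0 by apply/eqP => e; rewrite e invr0 mulr0 ltxx in d0.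
have : ev l (along x v (u0 / (u0 - u) * t)) != 0.
  apply: nz; rewrite mulr_ge0 ?(ltW d0) //= (le_trans _ td) // ler_piMl //.
  exact: ltW.
rewrite ev_along -/u0 -mulrA.
have -> : t * (ev l v - u0) = u - u0 by rewrite /u ev_along -/u0; ring.
suff -> : u0 + u0 / (u0 - u) * (u - u0) = 0 by rewrite eqxx.
by field.
Qed.

Context (A : set (set pt)) (arrA : arrangement A).
Local Notation same_stratum := (same_stratum A).

Lemma line_of l : A l -> is_line l. Proof. exact: arrA.1. Qed.

Lemma same_stratumE x y : same_stratum x y <-> forall m, A m -> sg m y = sg m x.
Proof.
split=> h m Am; have im := line_of Am.
  case: (h _ Am) => [[/(lineE _ im) e1 /(lineE _ im) e2]|].
    by rewrite /sg e1 e2.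
  by case/(same_sideE _ _ im).
have [x0|x0] := eqVneq (ev m x) 0.
  left; split; apply/(lineE _ im) => //.
  by have := h _ Am; rewrite {2}/sg x0 sgr0 => /sgr0P.
by right; apply/same_sideE => //; split=> //; exact: h.
Qed.

(* The face with [z] in its relative interior; it is a chamber if [off z] and an
   edge of [l] if [on1 l z]. *)
Definition Fc z : set pt := closure [set y | same_stratum z y].

(** A nonzero sign at [y] persists near [y]. Conversely, the segment from [y] to [z] lies, except
    perhaps for [y], in the stratum of [z]. *)
Lemma FcP z y : Fc z y <-> forall m, A m -> sg m y = 0 \/ sg m y = sg m z.
Proof.
split=> h.
  move=> m Am; have [y0|y0] := eqVneq (ev m y) 0; first by left; apply/sgr0P.
  have [w [/same_stratumE h1 h2]] := h _ (ev_near y0).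
  by right; rewrite -h2 h1.
move=> B /(@nbhs_along _ z)[d /andP[d0 d1] dB].
exists (along y z d); split; last by apply: dB; rewrite lexx (ltW d0).
by apply/same_stratumE => m Am; apply: along_sg; [rewrite d0|exact: h].
Qed.

Lemma Fc_sg z y m : Fc z y -> A m -> ev m y != 0 -> sg m y = sg m z.
Proof. by move=> /FcP h Am; case: (h _ Am) => // /sgr0P ->; rewrite eqxx. Qed.

Lemma Fc_refl z : Fc z z. Proof. by apply/FcP; right. Qed.

Lemma Fc_sub z w : Fc z w -> Fc w `<=` Fc z.
Proof.
move=> /FcP h y /FcP h'; apply/FcP => m Am.
case: (h' _ Am) => [->|->]; [by left|exact: h].
Qed.

Lemma FcE x y : Fc x = Fc y <-> forall m, A m -> sg m x = sg m y.
Proof.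
split=> h.
  have /FcP h1 : Fc y x by rewrite -h; exact: Fc_refl.
  have /FcP h2 : Fc x y by rewrite h; exact: Fc_refl.
  by move=> m Am; case: (h1 _ Am) (h2 _ Am) => [->|->] // [->|->].
apply/seteqP; split; apply: Fc_sub; apply/FcP => m Am; right; by rewrite h.
Qed.

(** One [t] serves all lines at once. Only finitely many lines meet a neighbourhood of [x], and a
    minimum handles these; any other line misses the whole short segment, so its sign cannot
    change. *)
Lemma along_near x v : exists2 t, 0 < t <= 1 &
  forall m, A m -> ev m x != 0 -> sg m (along x v t) = sg m x.
Proof.
have [U [nU /finite_seqP[s sE]]] := arrA.2 x.
have [d /andP[d0 d1] dU] := nbhs_along v nU.
have [e /andP[e0 ed] es] : exists2 e, 0 < e <= d &
    forall m, m \in s -> ev m x != 0 -> sg m (along x v e) = sg m x.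
  have : exists2 e, 0 < e <= d & forall m, m \in s -> ev m x != 0 ->
      forall t, 0 <= t <= e -> sg m (along x v t) = sg m x.
    elim: (s) => [|m s' [e /andP[e0 ed] IH]]; first by exists d; rewrite ?lexx ?d0.
    have [mx|mx] := eqVneq (ev m x) 0.
      exists e; first by rewrite e0.
      by move=> m'; rewrite inE => /orP[/eqP ->|/IH//]; rewrite mx eqxx.
    have [e' /andP[e'0 _] e's] := nbhs_along v (ev_near mx).
    exists (Num.min e e'); first by rewrite lt_min e0 e'0 ge_min ed.
    move=> m'; rewrite inE => /orP[/eqP -> _|/IH h] t.
      by rewrite le_min => /and3P[t0 _ te]; apply: e's; rewrite t0.
    by move=> m'x; rewrite le_min => /and3P[t0 te _]; apply: h; rewrite ?t0.
  by case=> e /andP[e0 ed] h; exists e; rewrite ?e0 // => m ms mx; apply: h; rewrite ?lexx ?ltW.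
exists e; first by rewrite e0 (le_trans ed).
move=> m Am mx.
have [ms|ms] := boolP (m \in s); first exact: es.
apply: (@sg_along_const _ _ _ d); last by rewrite ed ltW.
move=> t td; apply/eqP => /(lineE _ (line_of Am)) mt.
suff : [set` s] m by rewrite /= (negbTE ms).
by rewrite -sE; split=> //; exists (along x v t); split=> //; apply: dU.
Qed.

Definition off x := forall m, A m -> ev m x != 0.

Definition on1 l x := [/\ A l, ev l x = 0 & forall m, A m -> ev m x = 0 -> m = l].

Lemma on1_neq l x m : on1 l x -> A m -> m <> l -> ev m x != 0.
Proof. by move=> [_ _ h] Am ml; apply/eqP => /(h _ Am). Qed.

Lemma off_on1_or x : [\/ off x, exists l, on1 l x |
  exists l m, [/\ A l, A m, l <> m, ev l x = 0 & ev m x = 0]].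
Proof.
have [h|/existsNP[l /not_implyP[Al /negP/negPn/eqP lx]]] := pselect (off x).
  by constructor 1.
have [h|/existsNP[m /not_implyP[Am /not_implyP[mx /nesym ml]]]] :=
  pselect (forall m, A m -> ev m x = 0 -> m = l).
  by constructor 2; exists l.
by constructor 3; exists l, m.
Qed.

Lemma two_lines_pt l m x y : A l -> A m -> l <> m ->
  ev l x = 0 -> ev m x = 0 -> ev l y = 0 -> ev m y = 0 -> x = y.
Proof.
move=> Al Am lm.
have il := line_of Al; have im := line_of Am.
move=> /(lineE _ il) ? /(lineE _ im) ? /(lineE _ il) ? /(lineE _ im) ?.
by apply: contrapT => xy; apply/lm/(line_sub_eq il im xy).
Qed.

Lemma Fc_two_lines l m x : A l -> A m -> l <> m ->
  ev l x = 0 -> ev m x = 0 -> Fc x = [set x].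
Proof.
move=> Al Am lm lx mx; apply/seteqP; split=> y /=; last first.
  by move=> ->; exact: Fc_refl.
move=> /FcP h; apply: (two_lines_pt Al Am lm) => //; apply/sgr0P.
  by have := h _ Al; rewrite {3}/sg lx sgr0 => -[].
by have := h _ Am; rewrite {3}/sg mx sgr0 => -[].
Qed.

Lemma Fc_along x v t : 0 < t <= 1 ->
  (forall m, A m -> ev m x != 0 -> sg m (along x v t) = sg m x) ->
  (forall m, A m -> ev m x = 0 -> ev m v = 0) -> Fc x (along x v t).
Proof.
move=> t01 h h'; apply/FcP => m Am; have [x0|/(h _ Am)] := eqVneq (ev m x) 0.
  by left; apply/sgr0P; rewrite ev_along (h' _ Am) // x0 subrr mulr0 addr0.
by right.
Qed.

Lemma affine_closed_along S x y t : affine_closed S -> S x -> S y -> S (along x y t).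
Proof. exact. Qed.

(** A short step from [x] towards [v] stays in the face, and the line through its two ends reaches
    [v]. *)
Lemma span_Fc_sub x v : (forall m, A m -> ev m x = 0 -> ev m v = 0) ->
  affine_span (Fc x) v.
Proof.
move=> h S [aS sS]; have [t t01 tP] := along_near x v.
have Sx : S x by apply/sS/Fc_refl.
have St : S (along x v t) by apply/sS/Fc_along.
rewrite -(@along_alongV _ x v t); first exact: affine_closed_along.
by case/andP: t01 => t0 _; rewrite gt_eqF.
Qed.

Lemma span_off x : off x -> affine_span (Fc x) = setT.
Proof.
move=> ox; apply/seteqP; split=> // v _; apply: span_Fc_sub => m Am mx.
by have := ox _ Am; rewrite mx eqxx.
Qed.

Lemma affine_line l : is_line l -> affine_closed l.
Proof. by move=> il x y t; exact: line_along. Qed.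

Lemma on1_sub l x : on1 l x -> Fc x `<=` l.
Proof.
move=> [Al lx _] y /FcP h; apply/(lineE _ (line_of Al))/sgr0P.
by have := h _ Al; rewrite {3}/sg lx sgr0 => -[].
Qed.

Lemma span_on1 l x : on1 l x -> affine_span (Fc x) = l.
Proof.
move=> o1; have [Al lx h] := o1; apply/seteqP; split.
  apply: smallest_sub; [exact: affine_line (line_of Al)|exact: on1_sub].
move=> v /(lineE _ (line_of Al)) lv; apply: span_Fc_sub => m Am mx.
by rewrite (h _ Am mx).
Qed.

Lemma span_pt x : affine_span [set x] = [set x].
Proof.
apply/seteqP; split; last exact: sub_gen_smallest.
apply: smallest_sub => // y z t /= -> ->.
by rewrite !subrr !mulr0 !addr0; case: x.
Qed.

Lemma line_neq_setT l : is_line l -> l <> setT.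
Proof.
move=> il lT; have [nz _] := is_line_coef il.
have h x : ev l x = 0 by apply/(lineE _ il); rewrite lT.
have := h (0, 0); have := h (1, 0); have := h (0, 1); rewrite /ev /= => h1 h2 h3.
by case: nz => /eqP; apply; lra.
Qed.

Lemma line_neq_set1 l x : is_line l -> l <> [set x].
Proof.
move=> il lx; have xl : l x by rewrite lx.
have [y ly] := line_two_points il xl; apply.
by rewrite lx in ly.
Qed.

Lemma chamberP C : chamber A C <-> exists2 z, off z & C = Fc z.
Proof.
split; last by case=> z oz ->; split; [exists z|exact: span_off].
case=> -[z ->]; rewrite -/(Fc z) => cz; exists z => //.
have [//|[l o1]|[l [m [Al Am lm lz mz]]]] := off_on1_or z.
  by move: cz; rewrite /= (span_on1 o1) => /line_neq_setT[]; apply: line_of; case: o1.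
move: cz; rewrite /= (Fc_two_lines Al Am lm) // span_pt => zT.
have il := line_of Al; have lz' : l z by apply/lineE.
have [y _] := line_two_points il lz'.
by have : [set z] y by rewrite zT.
Qed.

Lemma edgeP F : edge A F <-> exists2 lz, on1 lz.1 lz.2 & F = Fc lz.2.
Proof.
split; last first.
  case=> -[l z] /= o1 ->; split; first by exists z.
  by rewrite /= (span_on1 o1); apply: line_of; case: o1.
case=> -[z ->]; rewrite -/(Fc z) /= => cz.
have [oz|[l o1]|[l [m [Al Am lm lz mz]]]] := off_on1_or z.
- by move: cz; rewrite (span_off oz) => /line_neq_setT[].
- by exists (l, z).
- by move: cz; rewrite (Fc_two_lines Al Am lm) // span_pt => /(@line_neq_set1 _ z)[].
Qed.

Lemma Fc_face z : face A (Fc z). Proof. by exists z. Qed.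

Lemma Fc_chamber z : off z -> chamber A (Fc z).
Proof. by move=> oz; apply/chamberP; exists z. Qed.

Lemma suppE z l : supp A (Fc z) l <-> A l /\ ev l z = 0.
Proof.
split=> -[Al h]; split=> //.
  by apply/(lineE _ (line_of Al))/h/Fc_refl.
move=> y /FcP /(_ _ Al); rewrite {3}/sg h sgr0.
by move=> [] /sgr0P /(lineE _ (line_of Al)).
Qed.

Lemma sepE x y l : off x -> off y ->
  sep A (Fc x) (Fc y) l <-> A l /\ sg l y = - sg l x.
Proof.
move=> ox oy; split=> -[Al]; last first.
  move=> h; split=> //; exists x, y; split; try exact: Fc_refl.
  by apply/(opposite_sidesE _ _ (line_of Al)); split=> //; exact: ox.
move=> [x' [y' [/FcP /(_ _ Al) hx /FcP /(_ _ Al) hy]]].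
move=> /(opposite_sidesE _ _ (line_of Al))[x0 xy]; split=> //.
have e : sg l x' = sg l x by case: hx => // /sgr0P x'0; rewrite x'0 eqxx in x0.
case: hy => [y0|<-]; last by rewrite -e.
by move: xy; rewrite y0 => /esym/eqP; rewrite oppr_eq0 sgr_eq0 (negbTE x0).
Qed.

(** The sign vector of [w] is the composition of the covectors of [z] and [x], realised by a short
    step from [z] towards [x]. *)
Lemma sg_toward x z : exists w, forall m, A m ->
  (ev m z = 0 -> sg m w = sg m x) /\ (ev m z != 0 -> sg m w = sg m z).
Proof.
have [t /andP[t0 t1] h] := along_near z x.
exists (along z x t) => m Am; split; last exact: h.
by move=> z0; rewrite /sg ev_along0 // sgrM gtr0_sg // mul1r.
Qed.

Lemma sg_away x z : exists w, forall m, A m ->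
  (ev m z = 0 -> sg m w = - sg m x) /\ (ev m z != 0 -> sg m w = sg m z).
Proof.
(* [along x z 2] is the reflection 2z - x of [x] in [z], which has the opposite sign on every line
   through [z]. *)
have [w h] := sg_toward (along x z 2) z.
exists w => m Am; have [h1 h2] := h m Am; split=> // z0; rewrite h1 //.
rewrite /sg ev_along z0 sub0r -sgrN; congr Num.sg; ring.
Qed.

Lemma off_sgE x y m : off x -> off y -> A m -> sg m y <> - sg m x -> sg m y = sg m x.
Proof. by move=> ox oy Am h; have [] := sgr_trichotomy (oy _ Am) (ox _ Am). Qed.

(** A chamber containing [Fc z] agrees with [z] on the lines that miss [z]; not being separated from
    [x] fixes its signs on the others. Hence uniqueness, while [sg_toward] gives existence. *)
Lemma dot_ex x z : off x -> exists w, [/\ off w, dot A (Fc x) (Fc z) = Fc w &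
  forall m, A m -> (ev m z = 0 -> sg m w = sg m x) /\ (ev m z != 0 -> sg m w = sg m z)].
Proof.
move=> ox; have [w h] := sg_toward x z.
have ow : off w.
  move=> m Am; have [h1 h2] := h _ Am; rewrite -sgr_eq0.
  have [z0|z0] := eqVneq (ev m z) 0.
    by rewrite -/(sg m w) h1 // sgr_eq0; exact: ox.
  by rewrite -/(sg m w) h2 // sgr_eq0.
exists w; split=> //; apply: xget_unique.
  split; first exact: Fc_chamber.
    apply/Fc_sub/FcP => m Am; have [h1 h2] := h _ Am.
    have [z0|z0] := eqVneq (ev m z) 0; first by left; apply/sgr0P.
    by right; rewrite h2.
  rewrite -subset0 => m [/suppE[Am mz] /(sepE _ ox ow)[_ e]].
  have [h1 _] := h _ Am; move: e; rewrite h1 //.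
  by apply: sgr_neq_oppr; exact: ox.
move=> _ [/chamberP[y oy ->] yz s0]; apply/FcE => m Am.
have [h1 h2] := h _ Am.
have [z0|z0] := eqVneq (ev m z) 0.
  rewrite h1 //; apply: off_sgE => // e.
  suff : (supp A (Fc z) `&` sep A (Fc x) (Fc y)) m by rewrite s0.
  by split; [apply/suppE|apply/sepE].
rewrite h2 //.
have /FcP/(_ _ Am)[/sgr0P zz|->//] : Fc y z by apply/yz/Fc_refl.
by rewrite zz eqxx in z0.
Qed.

Lemma opp_ex x z : off x -> Fc x z -> exists w, [/\ off w, Defs.opp A (Fc x) (Fc z) = Fc w &
  forall m, A m -> (ev m z = 0 -> sg m w = - sg m x) /\ (ev m z != 0 -> sg m w = sg m z)].
Proof.
move=> ox /FcP xz; have [w h] := sg_away x z.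
have ow : off w.
  move=> m Am; have [h1 h2] := h _ Am; rewrite -sgr_eq0.
  have [z0|z0] := eqVneq (ev m z) 0.
    by rewrite -/(sg m w) h1 // oppr_eq0 sgr_eq0; exact: ox.
  by rewrite -/(sg m w) h2 // sgr_eq0.
have zx m : A m -> ev m z != 0 -> sg m z = sg m x.
  by move=> Am z0; case: (xz _ Am) => // /sgr0P e; rewrite e eqxx in z0.
exists w; split=> //; apply: xget_unique.
  split; first exact: Fc_chamber.
    apply/Fc_sub/FcP => m Am; have [h1 h2] := h _ Am.
    have [z0|z0] := eqVneq (ev m z) 0; first by left; apply/sgr0P.
    by right; rewrite h2.
  apply/seteqP; split=> m.
    move=> /(sepE _ ox ow)[Am e]; apply/suppE; split=> //.
    apply/eqP/negPn/negP => z0; have [_ h2] := h _ Am.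
    by move: e; rewrite h2 // zx //; apply: sgr_neq_oppr; exact: ox.
  by move=> /suppE[Am z0]; apply/sepE => //; split=> //; case: (h _ Am) => ->.
move=> _ [/chamberP[y oy ->] yz s0]; apply/FcE => m Am.
have [h1 h2] := h _ Am.
have [z0|z0] := eqVneq (ev m z) 0.
  have /(sepE _ ox oy)[_ ->] : sep A (Fc x) (Fc y) m by rewrite s0; apply/suppE.
  by rewrite h1.
rewrite h2 //.
have /FcP/(_ _ Am)[/sgr0P zz|->//] : Fc y z by apply/yz/Fc_refl.
by rewrite zz eqxx in z0.
Qed.

Lemma dotE x z w : off x -> off w ->
  dot A (Fc x) (Fc z) = Fc w <-> forall m, A m ->
   (ev m z = 0 -> sg m w = sg m x) /\ (ev m z != 0 -> sg m w = sg m z).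
Proof.
move=> ox ow; have [w' [ow' -> h]] := dot_ex z ox.
rewrite FcE; split=> h' m Am; first by rewrite -(h' m Am); exact: h.
have [h1 h2] := h m Am; have [h3 h4] := h' m Am.
by have [z0|z0] := eqVneq (ev m z) 0; [rewrite h1 ?h3|rewrite h2 ?h4].
Qed.

Lemma oppE x z w : off x -> off w -> Fc x z ->
  Defs.opp A (Fc x) (Fc z) = Fc w <-> forall m, A m ->
   (ev m z = 0 -> sg m w = - sg m x) /\ (ev m z != 0 -> sg m w = sg m z).
Proof.
move=> ox ow xz; have [w' [ow' -> h]] := opp_ex ox xz.
rewrite FcE; split=> h' m Am; first by rewrite -(h' m Am); exact: h.
have [h1 h2] := h m Am; have [h3 h4] := h' m Am.
by have [z0|z0] := eqVneq (ev m z) 0; [rewrite h1 ?h3|rewrite h2 ?h4].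
Qed.

Lemma salP s : sal A s <-> exists x z, [/\ off x, Fc x z & s = (Fc x, Fc z)].
Proof.
split; last first.
  by case=> x [z [ox xz ->]]; split; [exact: Fc_chamber|exact: Fc_face|exact: Fc_sub].
case: s => C F [/= /chamberP[x ox Cx] [z Fz] zx].
have h : Fc x z. rewrite -Cx. apply: zx. rewrite Fz. exact: Fc_refl.
by exists x, z; split=> //; congr (_, _).
Qed.

Lemma SsetE x y z : off x -> off y -> Fc y z ->
  Sset A (Fc x) (Fc y, Fc z) <-> forall m, A m -> ev m z = 0 -> sg m y = sg m x.
Proof.
move=> ox oy /FcP yz; split.
  case=> _ /= /esym /dotE h m Am z0.
  by have [-> //] := h ox oy m Am.
move=> h; split; first by apply/salP; exists y, z; split=> //; apply/FcP.
apply/esym/dotE => // m Am; split; first exact: h.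
by move=> z0; case: (yz m Am) => // /sgr0P e; rewrite e eqxx in z0.
Qed.

End Faces.

(** * Distances and projections *)

Section Metric.
Context {R : realType}.
Local Notation pt := (R * R)%type.
Implicit Types (l m K S : set pt) (x y z v w r q : pt) (t : R).

Definition sqd x y : R := (x.1 - y.1) ^+ 2 + (x.2 - y.2) ^+ 2.

Lemma sqd_ge0 x y : 0 <= sqd x y.
Proof. by rewrite addr_ge0 ?sqr_ge0. Qed.

Lemma sqd_eq0 x y : sqd x y = 0 -> y = x.
Proof.
move/eqP; rewrite paddr_eq0 ?sqr_ge0 // !sqrf_eq0 !subr_eq0.
by case: x y => x1 x2 [y1 y2] /= /andP[/eqP -> /eqP ->].
Qed.

Lemma sqdxx x : sqd x x = 0.
Proof. by rewrite /sqd !subrr expr0n /= addr0. Qed.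

Lemma sqdC x y : sqd x y = sqd y x.
Proof. by rewrite /sqd -opprB sqrrN -(opprB y.2) sqrrN. Qed.

Lemma le_dist x y x' y' : (dist x y <= dist x' y') = (sqd x y <= sqd x' y').
Proof. by rewrite /dist ler_sqrt // sqd_ge0. Qed.

Lemma dist_ge0 x y : 0 <= dist x y. Proof. exact: sqrtr_ge0. Qed.

(** The hypothesis is the obtuse-angle criterion at [r] in squared form; the term [sqd r y] is what
    makes the minimiser unique. *)
Lemma proj_dist_set K x r : K r ->
    (forall y, K y -> sqd x r + sqd r y <= sqd x y) ->
  Defs.proj K x = r /\ dist_set x K = dist x r.
Proof.
move=> Kr h; have hle y : K y -> dist x r <= dist x y.
  by move=> Ky; rewrite le_dist (le_trans _ (h y Ky)) // lerDl sqd_ge0.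
split.
  apply: xget_unique => // y [Ky /(_ _ Kr)]; rewrite le_dist => yr.
  apply: sqd_eq0; apply/eqP; rewrite eq_le sqd_ge0 andbT.
  by have := h y Ky; lra.
apply/eqP; rewrite eq_le; apply/andP; split.
  apply: ge_inf; last by exists r.
  by exists 0 => _ [y _ <-]; exact: dist_ge0.
apply: lb_le_inf; first by exists (dist x r), r.
by move=> _ [y Ky <-]; exact: hle.
Qed.

Lemma dist_set_ge K x c : K !=set0 -> (forall y, K y -> c <= dist x y) ->
  c <= dist_set x K.
Proof.
move=> [r Kr] h; apply: lb_le_inf; first by exists (dist x r), r.
by move=> _ [y Ky <-]; exact: h.
Qed.

Lemma proj_mem_min K x : ~ K x -> K (Defs.proj K x) ->
  forall y, K y -> sqd x (Defs.proj K x) <= sqd x y.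
Proof.
move=> Kx; rewrite /Defs.proj; case: xgetP => [r -> [Kr h] _ y /h|_ /Kx//].
by rewrite le_dist.
Qed.

Lemma proj_self K x : K x -> Defs.proj K x = x /\ dist_set x K = 0.
Proof.
move=> Kx; have [|-> ->] := @proj_dist_set K x x Kx.
  by move=> y _; rewrite sqdxx add0r.
by split=> //; rewrite /dist -/(sqd x x) sqdxx sqrtr0.
Qed.

(** The angle at [y] is acute, since the difference [c] is twice the scalar product of [x - y] and
    [v - y]; so the distance to [x] has negative derivative towards [v]. *)
Lemma along_closer x y v : sqd x v < sqd x y + sqd y v ->
  exists2 d, 0 < d & forall t, 0 < t <= d -> sqd x (along y v t) < sqd x y.
Proof.
move=> h; set c := sqd x y + sqd y v - sqd x v.
have c0 : 0 < c by rewrite subr_gt0.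
have n0 := sqd_ge0 y v.
have s0 : 0 < c + sqd y v by rewrite ltr_wpDr.
(* Chosen so that [t * sqd y v < c], without a division by [sqd y v]. *)
exists (c / (c + sqd y v) / 2); first by rewrite !divr_gt0.
move=> t /andP[t0 tc].
have -> : sqd x (along y v t) = sqd x y - t * (c - t * sqd y v).
  by rewrite /c /sqd /along /=; ring.
rewrite gtrBl pmulr_rgt0 // subr_gt0.
apply: (le_lt_trans (ler_wpM2r n0 tc)).
have -> : c / (c + sqd y v) / 2 * sqd y v = (c * sqd y v / 2) / (c + sqd y v).
  by field; rewrite gt_eqF.
rewrite ltr_pdivrMr //; have := mulr_gt0 c0 c0; have := mulr_ge0 (ltW c0) n0; lra.
Qed.

Definition foot l x : pt :=
  let s := (coef l).1.1 ^+ 2 + (coef l).1.2 ^+ 2 in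
  (x.1 - ev l x * (coef l).1.1 / s, x.2 - ev l x * (coef l).1.2 / s).

(** The law of cosines at the foot. The scalar product is proportional to [ev l x * ev l y], so its
    sign tells whether [x] and [y] lie on the same side of [l]. *)
Lemma foot_sqd l x y : is_line l -> sqd x y =
  sqd x (foot l x) + sqd (foot l x) y
  - 2 * (ev l x * ev l y) / ((coef l).1.1 ^+ 2 + (coef l).1.2 ^+ 2).
Proof.
move=> il; have [nz _] := is_line_coef il.
have := sqr_norm_gt0 nz; rewrite /sqd /foot /ev /=.
case: (coef l) => -[a b] c /= s0; by field; rewrite gt_eqF.
Qed.

Lemma ev_foot l x : is_line l -> ev l (foot l x) = 0.
Proof.
move=> il; have [nz _] := is_line_coef il.
have := sqr_norm_gt0 nz; rewrite /foot /ev /=.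
case: (coef l) => -[a b] c /= s0; by field; rewrite gt_eqF.
Qed.

Lemma foot_pythagoras l x y : is_line l -> ev l y = 0 ->
  sqd x y = sqd x (foot l x) + sqd (foot l x) y.
Proof. by move=> il ly; rewrite (foot_sqd _ _ il) ly !mulr0 mul0r subr0. Qed.

Lemma foot_half_plane l x y : is_line l -> ev l x * ev l y <= 0 ->
  sqd x (foot l x) + sqd (foot l x) y <= sqd x y.
Proof.
move=> il h; rewrite [leRHS](foot_sqd x y il) lerDl oppr_ge0.
have [nz _] := is_line_coef il.
by rewrite pmulr_lle0 ?invr_gt0 ?sqr_norm_gt0 // pmulr_rle0.
Qed.

Lemma proj_line l x : is_line l ->
  Defs.proj l x = foot l x /\ dist_set x l = dist x (foot l x).
Proof.
move=> il; apply: proj_dist_set; first by apply/lineE => //; exact: ev_foot.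
by move=> y /(lineE _ il) ly; rewrite (foot_pythagoras x il ly).
Qed.

Lemma sqd_along_le0 q y t : t <= 0 ->
  sqd (along q y t) q + sqd q y <= sqd (along q y t) y.
Proof.
move=> t0; have -> : sqd (along q y t) q = t ^+ 2 * sqd q y.
  by rewrite /sqd /along /=; ring.
have -> : sqd (along q y t) y = (1 - t) ^+ 2 * sqd q y.
  by rewrite /sqd /along /=; ring.
rewrite -subr_ge0; have -> : (1 - t) ^+ 2 * sqd q y - (t ^+ 2 * sqd q y + sqd q y)
  = 2 * (- t) * sqd q y by ring.
by rewrite !mulr_ge0 ?sqd_ge0 // oppr_ge0.
Qed.

End Metric.

Section FacesMetric.
Context {R : realType}.
Local Notation pt := (R * R)%type.
Context (A : set (set pt)) (arrA : arrangement A).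
Implicit Types (l m K S F : set pt) (x y z v w r q : pt) (t : R).
Local Notation Fc := (Fc A).
Local Notation off := (off A).
Local Notation on1 := (on1 A).
Local Notation line_of := (line_of arrA).

Lemma collinear_along l m r q y : A l -> A m -> l <> m ->
    ev l r = 0 -> ev l q = 0 -> ev l y = 0 -> ev m q = 0 -> ev m y != 0 ->
  r = along q y (ev m r / ev m y).
Proof.
move=> Al Am lm lr lq ly mq y0; set r' := along q y _.
have lr' : ev l r' = 0 by rewrite ev_along lq ly; ring.
have mr' : ev m r' = ev m r by rewrite ev_along0 // divfK.
(* q' = q + (r - r') lies on both lines, hence is q *)
pose q' : pt := (q.1 + r.1 - r'.1, q.2 + r.2 - r'.2).
have evq' k : ev k q' = ev k q + ev k r - ev k r' by rewrite /ev /=; ring.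
have /esym : q = q'.
  by apply: (two_lines_pt arrA Al Am lm) => //; rewrite evq' ?lq ?lr ?lr' ?mq ?mr'; ring.
clearbody r'; rewrite /q'; case: (q) (r) (r') => q1 q2 [r1 r2] [r1' r2'] /= [h1 h2].
by congr (_, _); lra.
Qed.

(** On [l], the line [m] cuts at [q] and weakly separates [r] from [y]; so [q] lies between them,
    and squared length is superadditive. *)
Lemma sqd_between l m r q y : A l -> A m -> l <> m ->
    ev l r = 0 -> ev l q = 0 -> ev l y = 0 -> ev m q = 0 ->
    ev m y * ev m r <= 0 ->
  sqd r q + sqd q y <= sqd r y.
Proof.
move=> Al Am lm lr lq ly mq h.
have [y0|y0] := eqVneq (ev m y) 0.
  by rewrite (two_lines_pt arrA Al Am lm ly y0 lq mq) sqdxx addr0.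
rewrite (collinear_along Al Am lm lr lq ly mq y0).
apply: sqd_along_le0.
have -> : ev m r / ev m y = (ev m y * ev m r) / (ev m y) ^+ 2 by field.
by rewrite pmulr_lle0 // invr_gt0 exprn_even_gt0.
Qed.

Lemma along_near_le x v : exists2 d, 0 < d <= 1 & forall t, 0 < t <= d ->
  forall m, A m -> ev m x != 0 -> sg m (along x v t) = sg m x.
Proof.
have [d d01 h] := along_near arrA x v; exists d => // t /andP[t0 td] m Am mx.
have /andP[d0 d1] := d01.
have -> : along x v t = along x (along x v d) (t / d).
  by rewrite /along /=; congr (_, _); field; rewrite gt_eqF.
have t1 : 0 < t / d <= 1 by rewrite divr_gt0 // ler_pdivrMr // mul1r.
by rewrite (along_sg t1) h //; right.
Qed.

Lemma along_in_chamber l y y0 v : on1 l y -> off y0 -> Fc y0 y ->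
    ev l v = 0 \/ sg l v = sg l y0 ->
  exists2 d, 0 < d <= 1 & forall t, 0 < t <= d -> Fc y0 (along y v t).
Proof.
move=> o1 oy0 /(FcP arrA) yy0 lv; have [Al ly _] := o1.
have [d d01 h] := along_near_le y v; exists d => // t td.
apply/(FcP arrA) => m Am; have [->|/eqP ml] := eqVneq m l.
  have t0 : 0 < t by case/andP: td.
  case: lv => [lv|<-]; [left|right]; rewrite /sg ev_along0 //.
    by rewrite lv mulr0 sgr0.
  by rewrite sgrM gtr0_sg // mul1r.
have my := on1_neq o1 Am ml; rewrite (h t td m Am my); exact: yy0.
Qed.

(** [v] may lie outside the chamber: minimality is tested only on a short initial segment from [y]
    to [v], and this remains in the chamber because [l] is the only line through [y]. *)
Lemma proj_variation l x y y0 v : on1 l y -> off y0 -> Fc y0 y ->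
    ~ Fc y0 x -> Defs.proj (Fc y0) x = y -> ev l v = 0 \/ sg l v = sg l y0 ->
  sqd x y + sqd y v <= sqd x v.
Proof.
move=> o1 oy0 yy0 xy0 py lv; rewrite leNgt; apply/negP => /along_closer[d d0 dP].
have [e /andP[e0 _] eP] := along_in_chamber o1 oy0 yy0 lv.
pose t := Num.min d e; have t0 : 0 < t by rewrite lt_min d0.
have := dP t; rewrite t0 ge_min lexx /= => /(_ isT); apply/negP; rewrite -leNgt -py.
apply: proj_mem_min => //; first by rewrite py.
by rewrite py; apply: eP; rewrite t0 ge_min lexx orbT.
Qed.

Lemma off_mem_eq x y : off x -> Fc y x -> Fc y = Fc x.
Proof.
move=> ox /(FcP arrA) h; apply/(FcE arrA) => m Am.
by case: (h _ Am) => [/sgr0P/eqP|->//]; rewrite (negbTE (ox _ Am)).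
Qed.

Lemma on1_mem_eq l x y : on1 l x -> on1 l y -> Fc y x -> Fc y = Fc x.
Proof.
move=> o1 [_ ly _] /(FcP arrA) h; apply/(FcE arrA) => m Am.
have [->|/eqP ml] := eqVneq m l.
  by have [_ lx _] := o1; rewrite /sg lx ly.
by case: (h _ Am) => [/sgr0P/eqP|->//]; rewrite (negbTE (on1_neq o1 Am ml)).
Qed.

End FacesMetric.

(** * The sets N(C) of edges *)

Section BasePoint.
Context {R : realType}.
Local Notation pt := (R * R)%type.
Context (A : set (set pt)) (arrA : arrangement A) (x0 : pt) (gx : generic A x0).
Implicit Types (l m K S F C : set pt) (x y z v w r q : pt) (t : R).
Implicit Types (prec : set pt -> set pt -> Prop).
Local Notation Fc := (Fc A).
Local Notation off := (off A).
Local Notation on1 := (on1 A).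
Local Notation line_of := (line_of arrA).

Lemma flat_line l : A l -> flat A l.
Proof.
move=> Al; split; last by exists [set l]; [move=> _ ->|rewrite bigcap_set1].
by exists (foot l x0); apply/(lineE _ (line_of Al))/ev_foot/line_of.
Qed.

(** Condition (ii) for a line inside the plane: if [x0] were on the line, both distances would be
    0. *)
Lemma x0_off : off x0.
Proof.
move=> l Al; apply/eqP => lx; have lx' : l x0 by apply/lineE => //; exact: line_of.
have flatT : flat A setT by split; [exists x0|exists set0; rewrite ?bigcap_set0].
have : l `<` [set: pt].
  by rewrite properEneq; split=> //; apply/eqP/line_neq_setT/line_of.
move/(gx.2 _ _ flatT (flat_line Al)).
by rewrite (proj_self lx').2 (@proj_self _ setT x0 I).2 ltxx.
Qed.

(** Condition (ii) for [l] and its intersection with another line: if that line passed through the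
    foot, both flats would be equally far from [x0]. *)
Lemma foot_on1 l : A l -> on1 l (foot l x0).
Proof.
move=> Al; have il := line_of Al; have lf := ev_foot x0 il.
split=> // m Am mf; apply: contrapT => ml.
have im := line_of Am; set L := l `&` m.
have Lf : L (foot l x0) by split; apply/lineE.
have flatL : flat A L.
  split; first by exists (foot l x0).
  by exists [set l; m]; [move=> _ [->|->]|rewrite bigcap_setU !bigcap_set1].
have : L `<` l.
  rewrite properEneq; split; last by move=> y [].
  apply/eqP => Ll; have lfoot : l (foot l x0) by case: Lf.
  have [y ly yf] := line_two_points il lfoot.
  have [_ my] : L y by rewrite Ll.
  by apply/ml/(line_sub_eq im il yf); case: Lf.
move/(gx.2 _ _ (flat_line Al) flatL).
have [_ ->] : Defs.proj L x0 = foot l x0 /\ dist_set x0 L = dist x0 (foot l x0).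
  apply: proj_dist_set => // y [/(lineE _ il) ly _].
  by rewrite (foot_pythagoras x0 il ly).
by rewrite (proj_line x0 il).2 ltxx.
Qed.

Lemma base_chamberE : base_chamber A x0 = Fc x0.
Proof.
apply: xget_unique; first by split; [exact/(Fc_chamber arrA)/x0_off|exact: Fc_refl].
by move=> _ [/(chamberP arrA)[y oy ->]]; exact: (off_mem_eq arrA x0_off).
Qed.

Lemma beyond_line_dist l w y : A l -> sg l w = - sg l x0 -> Fc w y ->
  sqd x0 (foot l x0) + sqd (foot l x0) y <= sqd x0 y.
Proof.
move=> Al lw /(FcP arrA)/(_ _ Al) h; apply: foot_half_plane; first exact: line_of.
rewrite -sgr_le0 sgrM; case: h; rewrite /sg => ->; first by rewrite mulr0.
by rewrite -/(sg l w) lw -/(sg l x0) mulrN oppr_le0 -expr2 sqr_ge0.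
Qed.

Lemma beyond_proj l w : A l -> sg l w = - sg l x0 -> Fc w (foot l x0) ->
  Defs.proj (Fc w) x0 = foot l x0 /\ dist_set x0 (Fc w) = dist x0 (foot l x0).
Proof.
by move=> Al lw wf; apply: proj_dist_set => // y; exact: beyond_line_dist.
Qed.

(** [Fc w] is the chamber C whose N(C) receives the cells <C(F),F> of all edges F on [l]. *)
Lemma beyond_foot_ex l : A l ->
  exists w, [/\ off w, Fc w (foot l x0) & sg l w = - sg l x0].
Proof.
move=> Al; have o1 := foot_on1 Al.
have [w h] := sg_away arrA x0 (foot l x0).
have ow : off w.
  move=> m Am; have [h1 h2] := h m Am; rewrite -sgr_eq0 -/(sg m w).
  have [f0|f0] := eqVneq (ev m (foot l x0)) 0; last by rewrite h2 // sgr_eq0.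
  by rewrite h1 // oppr_eq0 sgr_eq0 x0_off.
exists w; split=> //; last by case: o1 => _ lf _; have [->] := h l Al.
apply/(FcP arrA) => m Am; have [h1 h2] := h m Am.
have [f0|f0] := eqVneq (ev m (foot l x0)) 0; first by left; apply/sgr0P.
by right; rewrite h2.
Qed.

Section Order.
Context (prec : set pt -> set pt -> Prop) (ep : euclidean_order A x0 prec).

(** An earlier chamber would be at distance 0 from [x0], so condition (i) would put [x0] in it. *)
Lemma base_chamber_first C : chamber A C -> ~ prec C (Fc x0).
Proof.
move=> cC pC; have [_ [irr _ _ _] mono] := ep.
have c0 := Fc_chamber arrA x0_off.
have x00 : Fc x0 x0 by exact: Fc_refl.
have [p0 d0] := proj_self x00.
have [y oy Cy] := (chamberP arrA C).1 cC.
have dC : dist_set x0 C = dist_set x0 (Fc x0).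
  apply/eqP; rewrite eq_le (mono _ _ cC c0 pC) d0 /=.
  by apply: dist_set_ge => [|z _]; [exists y; rewrite Cy; exact: Fc_refl|exact: dist_ge0].
have [pE [Cp _]] := gx.1 _ _ cC c0 dC.
rewrite pE p0 Cy in Cp; have e := off_mem_eq arrA x0_off Cp.
by rewrite Cy e in pC; exact: irr pC.
Qed.

Lemma Nset_base s : Nset A prec (Fc x0) s <-> Sset A (Fc x0) s.
Proof. by split=> [[]//|h]; split=> // C cC /(base_chamber_first cC). Qed.

Lemma eta_Nset_eq C s : chamber A C -> Nset A prec C s -> (eta A prec s).1 = C.
Proof.
move=> cC NC; apply: xget_unique => // C' [cC' NC'].
have [_ [_ _ tot _] _] := ep; apply: contrapT => CC'.
case: (tot _ _ cC' cC CC') => h.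
  by apply: (NC.2 _ cC' h); case: NC'.
by apply: (NC'.2 _ cC h); case: NC.
Qed.

(** The point [x] excludes the default value [set0] of [xget]. *)
Lemma eta_eq_Nset C s x : C x -> (eta A prec s).1 = C -> Nset A prec C s.
Proof. by rewrite /eta /=; case: xgetP => [C' -> [_ N] _ <- //|_ Cx C0]; rewrite -C0 in Cx. Qed.

(** An earlier chamber whose S contains the cell also lies beyond [l], hence is as far from [x0] as
    the foot. By condition (i) it contains the foot, and since only [l] passes there it equals
    [Fc w]. *)
Lemma beyond_Nset l z y w : on1 l z -> off y -> Fc y z -> sg l y = - sg l x0 ->
    off w -> Fc w (foot l x0) -> sg l w = - sg l x0 ->
  Nset A prec (Fc w) (Fc y, Fc z).
Proof.
move=> o1 oy yz ly ow wf lw; have [Al lz _] := o1; split.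
  by apply/(SsetE arrA) => // m Am mz; case: o1 => _ _ /(_ _ Am mz) ->; rewrite ly.
move=> C cC pC SC; have [u ou Cu] := (chamberP arrA C).1 cC.
rewrite Cu in cC pC SC.
have lu : sg l u = - sg l x0 by rewrite -ly; have := (SsetE arrA ou oy yz).1 SC l Al lz.
have [_ [irr _ _ _] mono] := ep; have cw := Fc_chamber arrA ow.
have [pw dw] := beyond_proj Al lw wf.
have dE : dist_set x0 (Fc u) = dist_set x0 (Fc w).
  apply/eqP; rewrite eq_le (mono _ _ cC cw pC) dw /=.
  apply: dist_set_ge => [|v uv]; first by exists u; exact: Fc_refl.
  have := beyond_line_dist Al lu uv; rewrite le_dist; apply: le_trans.
  by rewrite lerDl sqd_ge0.
have [pE [up _]] := gx.1 _ _ cC cw dE.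
rewrite pE pw in up.
have e : Fc u = Fc w.
  apply/(FcE arrA) => m Am; have [->|/eqP ml] := eqVneq m l; first by rewrite lu lw.
  have mf := on1_neq (foot_on1 Al) Am ml.
  by rewrite -(Fc_sg arrA up Am mf) -(Fc_sg arrA wf Am mf).
by rewrite e in pC; exact: irr pC.
Qed.

Lemma edge_Nset_base l z y : on1 l z -> off y -> Fc y z ->
  ~ Nset A prec (base_chamber A x0) (Fc y, Fc z) <-> sg l y = - sg l x0.
Proof.
move=> o1 oy yz; rewrite base_chamberE Nset_base; have [Al lz uniq] := o1.
have ox := x0_off; split=> [h|ly].
  have [e|//] := sgr_trichotomy (oy l Al) (ox l Al).
  by case: h; apply/(SsetE arrA) => // m Am /(uniq _ Am) ->.
move/(SsetE arrA ox oy yz)/(_ l Al lz); rewrite ly => /esym.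
by apply: sgr_neq_oppr; exact: ox.
Qed.

Lemma C_of_ex l z : on1 l z ->
  exists y, [/\ off y, Fc y z, sg l y = - sg l x0 & C_of A prec x0 (Fc z) = Fc y].
Proof.
move=> o1; have [Al lz uniq] := o1.
have [y h] := sg_away arrA x0 z.
have oy : off y.
  move=> m Am; have [h1 h2] := h m Am; rewrite -sgr_eq0 -/(sg m y).
  have [f0|f0] := eqVneq (ev m z) 0; last by rewrite h2 // sgr_eq0.
  by rewrite h1 // oppr_eq0 sgr_eq0 x0_off.
have yz : Fc y z.
  apply/(FcP arrA) => m Am; have [h1 h2] := h m Am.
  have [f0|f0] := eqVneq (ev m z) 0; first by left; apply/sgr0P.
  by right; rewrite h2.
have ly : sg l y = - sg l x0 by have [->] := h l Al.
exists y; split=> //; apply: xget_unique.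
  split; [exact: Fc_chamber|exact: Fc_sub|].
  exact/(edge_Nset_base o1 oy yz).
move=> _ [/(chamberP arrA)[u ou ->] zu]; have uz : Fc u z by apply/zu/Fc_refl.
move=> /(edge_Nset_base o1 ou uz) lu; apply/(FcE arrA) => m Am.
have [->|/eqP ml] := eqVneq m l; first by rewrite lu ly.
have mz := on1_neq o1 Am ml.
by rewrite -(Fc_sg arrA uz Am mz) -(Fc_sg arrA yz Am mz).
Qed.

Lemma C_ofE l z y : on1 l z -> off y -> Fc y z -> sg l y = - sg l x0 ->
  C_of A prec x0 (Fc z) = Fc y.
Proof.
move=> o1 oy yz ly; have [u [ou uz lu ->]] := C_of_ex o1.
apply/(FcE arrA) => m Am.
have [->|/eqP ml] := eqVneq m l; first by rewrite lu ly.
have mz := on1_neq o1 Am ml.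
by rewrite -(Fc_sg arrA uz Am mz) -(Fc_sg arrA yz Am mz).
Qed.

End Order.
End BasePoint.

(** * The matched cell of an edge *)

Section Matching.
Context {R : realType}.
Local Notation pt := (R * R)%type.
Context (A : set (set pt)) (arrA : arrangement A) (x0 : pt) (gx : generic A x0).
Context (M : set ((set pt * set pt) * (set pt * set pt))).
Context (em : euclidean_matching A x0 M).
Context (prec : set pt -> set pt -> Prop) (ep : euclidean_order A x0 prec).
Implicit Types (l m K S F G C : set pt) (x y z v w r q : pt) (t : R).
Local Notation Fc := (Fc A).
Local Notation off := (off A).
Local Notation on1 := (on1 A).
Local Notation line_of := (line_of arrA).
Local Notation x0_off := (x0_off arrA gx).

(* The cells <C(F),F> and <D(F),p(F)>. *)
Definition tau F := (C_of A prec x0 F, F).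

Definition sigma F := (D_of A prec x0 F, [set p_of A x0 F]).

Lemma p_definedE l z : on1 l z ->
  p_defined x0 (Fc z) <-> ~ Fc z (foot l x0).
Proof.
move=> o1; rewrite /p_defined (span_on1 arrA o1).
by rewrite (proj_line x0 _).1 //; case: o1 => /line_of.
Qed.

Lemma p_of_eq l z p : on1 l z -> Fc z p -> face A [set p] ->
    (forall y, Fc z y -> sqd (foot l x0) p + sqd p y <= sqd (foot l x0) y) ->
  p_of A x0 (Fc z) = p.
Proof.
move=> o1 zp fp h; have il : is_line l by apply: line_of; case: o1.
rewrite /p_of (span_on1 arrA o1) (proj_line x0 il).1.
apply: xget_unique.
  split=> // q [_ zq]; rewrite le_dist (le_trans _ (h q zq)) //.
  by rewrite lerDl sqd_ge0.
move=> q [[_ zq] /(_ p (conj fp zp))]; rewrite le_dist => qp.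
apply: sqd_eq0; apply/eqP; rewrite eq_le sqd_ge0 andbT.
by have := h q zq; lra.
Qed.

Lemma critical_foot l z : on1 l z -> Fc z (foot l x0) -> critical A M (tau (Fc z)).
Proof.
move=> o1 zf; have [Al _ _] := o1; have [_ _ _ _ cr] := em.
have [y [oy yz ly yE]] := C_of_ex arrA gx ep o1.
rewrite cr /tau yE /=; split; first exact: Fc_chamber.
have yf : Fc y (foot l x0) by apply: (Fc_sub arrA yz).
rewrite (beyond_proj arrA Al ly yf).1; split=> //; first exact: Fc_face.
  exact: Fc_sub.
move=> _ [g ->] _ gf; rewrite (on1_mem_eq arrA (foot_on1 arrA gx Al) o1 zf).
exact: (Fc_sub arrA gf).
Qed.

(** The projection [r] is not a vertex, since {r} would then be a smaller face than the edge. So [l]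
    is the only line through [r], and first variation applies there. *)
Lemma critical_edge l z y : on1 l z -> off y -> Fc y z ->
  critical A M (Fc y, Fc z) -> sg l y = - sg l x0 /\ Fc z (foot l x0).
Proof.
move=> o1 oy yz; have [Al lz uniq] := o1; have [_ _ _ _ cr] := em.
rewrite cr /=; set r := Defs.proj (Fc y) x0 => -[_ [_ _ zr sm]].
have yr : Fc y r by apply: (Fc_sub arrA yz).
have lr : ev l r = 0.
  by apply/(lineE _ (line_of Al)); apply: (on1_sub arrA o1).
have or1 : on1 l r.
  split=> // m Am mr; apply: contrapT => ml.
  have rE := Fc_two_lines arrA Am Al ml mr lr.
  have /(_ z (@Fc_refl _ _ arrA _)) : Fc z `<=` [set r].
    by rewrite -rE; apply: sm; [exact: Fc_face|exact: Fc_sub|exact: Fc_refl].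
  by move=> /= zE; apply/ml/uniq => //; rewrite zE.
have rx : r <> x0 by move=> e; have := x0_off Al; rewrite -e lr eqxx.
have yx : ~ Fc y x0.
  by move=> yx; apply: rx; rewrite /r (proj_self yx).1.
have ly : sg l y = - sg l x0.
  have [e|//] := sgr_trichotomy (oy l Al) (x0_off Al).
  (* If the chamber were on the side of [x0], moving from [r] towards [x0] itself would force
     [r = x0]. *)
  have := proj_variation arrA or1 oy yr yx (erefl r) (or_intror (esym e)).
  rewrite sqdxx => h; case: rx; apply: sqd_eq0; apply/eqP.
  by rewrite eq_le sqd_ge0 andbT; have := sqd_ge0 r x0; lra.
split=> //; have il := line_of Al.
(* Moving along [l] towards the foot gives [r = foot l x0]. *)
have := proj_variation arrA or1 oy yr yx (erefl r) (or_introl (ev_foot x0 il)).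
rewrite (foot_pythagoras x0 il lr) (sqdC r) => h.
suff <- : r = foot l x0 by [].
apply: sqd_eq0; apply/eqP; rewrite eq_le sqd_ge0 andbT; lra.
Qed.

Lemma face_proper_edge l z q : on1 l z -> Fc q `<` Fc z ->
  exists m, [/\ A m, m <> l, ev m q = 0, ev l q = 0 & Fc q = [set q]].
Proof.
move=> o1 [qz zq]; have [Al lz uniq] := o1.
have zq' : Fc z q by apply/qz/Fc_refl.
have lq : ev l q = 0.
  by apply/(lineE _ (line_of Al)); apply: (on1_sub arrA o1).
have [/existsNP[m /not_implyP[Am /not_implyP[mq ml]]]|/contrapT uq] :=
  pselect (~ forall m, A m -> ev m q = 0 -> m = l).
  by exists m; split=> //; apply: (Fc_two_lines arrA Am Al ml mq lq).
by case: zq; rewrite (on1_mem_eq arrA _ o1 zq').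
Qed.

Lemma edge_proper_face l z w : on1 l z -> Fc z `<` Fc w -> off w.
Proof.
move=> o1 [zw wz]; have [Al lz uniq] := o1.
have wz' : Fc w z by apply/zw/Fc_refl.
move=> m Am; apply/eqP => mw; apply: wz.
have mz : ev m z = 0.
  by move/(FcP arrA)/(_ m Am): wz'; rewrite {3}/sg mw sgr0 => -[] /sgr0P.
have lw : ev l w = 0 by rewrite -(uniq m Am mz).
suff -> : Fc w = Fc z by [].
apply/(FcE arrA) => k Ak; have [->|/eqP kl] := eqVneq k l.
  by rewrite /sg lz lw.
by rewrite (Fc_sg arrA wz' Ak (on1_neq o1 Ak kl)).
Qed.

Lemma dim0_Sset w : off w -> Sset A (Fc x0) (Fc w, Fc w).
Proof.
move=> ow; apply/(SsetE arrA x0_off ow (@Fc_refl _ _ arrA _)) => m Am mw.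
by have := ow m Am; rewrite mw eqxx.
Qed.

(* The chamber of [eta] on the cell of a non-critical edge is the one beyond
   its line at the projection of [x0]; for the matched vertex this forces the
   vertex to lie between the projection of [x0] and the edge. *)
Lemma matched_edge l z : on1 l z -> ~ Fc z (foot l x0) ->
  M (sigma (Fc z), tau (Fc z)) /\
  exists m p x, [/\ [/\ A m, m <> l, ev l p = 0 & ev m p = 0],
    Fc z p, p_of A x0 (Fc z) = p,
    [/\ off x, Fc x p & D_of A prec x0 (Fc z) = Fc x] &
    sg l x = - sg l x0 /\
    forall k, A k -> k <> l -> ev k p = 0 -> sg k x = - sg k z].
Proof.
move=> o1 zf; have [Al lz uniq] := o1.
have [[Mcov Muniq] _ _ [prec' ep' eta_inv] cr] := em.
have [y [oy yz ly yE]] := C_of_ex arrA gx ep o1.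
have [w [ow wf lw]] := beyond_foot_ex arrA gx Al.
have st : sal A (Fc y, Fc z) by apply/(salP arrA); exists y, z.
have eta_t : (eta A prec' (Fc y, Fc z)).1 = Fc w.
  apply: (eta_Nset_eq ep' (Fc_chamber arrA ow)).
  exact: (beyond_Nset arrA gx ep' o1 oy yz ly ow wf lw).
have [e [Me te]] : exists e, M e /\ ((Fc y, Fc z) = e.1 \/ (Fc y, Fc z) = e.2).
  apply: contrapT => h; have [] : sg l y = - sg l x0 /\ Fc z (foot l x0).
    apply: critical_edge => //; split=> // e Me.
    by split=> te; apply: h; exists e; split=> //; [left|right].
  by move=> _ /zf.
case: e => e1 e2 in Me te; case: te => /= te; subst.
  (* Were the edge the upper cell of its pair, its partner would be a 0-cell. All 0-cells lie in
     N(C_0), whereas [eta] sends the edge beyond [l]. *)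
  have [[s2 _ lt2 _] _] := Mcov _ _ Me.
  have [x1 [z1 [ox1 xz1 e2E]]] := (salP arrA _).1 s2.
  rewrite e2E /= in lt2; have oz1 := edge_proper_face o1 lt2.
  have e := off_mem_eq arrA oz1 xz1.
  have eta2 : (eta A prec' e2).1 = Fc x0.
    apply: (eta_Nset_eq ep' (Fc_chamber arrA x0_off)).
    by apply/(Nset_base arrA gx ep'); rewrite e2E e; exact: dim0_Sset.
  rewrite -(eta_inv _ _ Me) eta_t in eta2.
  move/(FcE arrA)/(_ l Al): eta2; rewrite lw => /esym.
  by move/sgr_neq_oppr => /(_ (x0_off Al)).
have [[_ s1 lt1 dE] _] := Mcov _ _ Me.
have [x1 [q [ox1 xq e1E]]] := (salP arrA _).1 s1.
rewrite e1E /= in lt1 dE.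
have [m [Am ml mq lq qE]] := face_proper_edge o1 lt1.
have zq : Fc z q by case: lt1 => h _; apply/h/Fc_refl.
have etaE := eta_inv _ _ Me.
have N1 : Nset A prec' (Fc w) e1.
  by apply: (eta_eq_Nset (@Fc_refl _ _ arrA _)); rewrite etaE.
have S1 : forall k, A k -> ev k q = 0 -> sg k x1 = sg k w.
  by apply/(SsetE arrA ow ox1 xq); rewrite -e1E; case: N1.
have [y' [oy' y'E y'P]] := opp_ex arrA oy yz.
have oppq : Defs.opp A (Fc x1) (Fc q) = Fc y'.
  by rewrite -y'E; move: etaE; rewrite e1E /eta /= => -[].
have y'q := (oppE arrA ox1 oy' xq).1 oppq.
have wl k : A k -> k <> l -> sg k w = sg k (foot l x0).
  by move=> Ak kl; rewrite (Fc_sg arrA wf Ak (on1_neq (foot_on1 arrA gx Al) Ak kl)).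
(* [Fc y'] is both D^q and C(F)^F: off [l] it has the signs of [z], and D reverses them on the lines
   through [q]. *)
have x1z k : A k -> k <> l -> ev k q = 0 -> sg k x1 = - sg k z.
  move=> Ak kl kq; have [_ <-] := y'P k Ak; last exact: on1_neq o1 Ak kl.
  by have [-> //] := y'q k Ak; rewrite opprK.
have pE : p_of A x0 (Fc z) = q.
  apply: (p_of_eq o1 zq); first by rewrite -qE; exact: Fc_face.
  move=> u zu.
  apply: (sqd_between arrA Al Am (nesym ml)) => //.
  - exact/ev_foot/line_of.
  - by apply/(lineE _ (line_of Al)); apply: (on1_sub arrA o1).
  - have fz : sg m (foot l x0) = - sg m z by rewrite -wl // -S1 // x1z.
    rewrite -sgr_le0 sgrM -!/(sg _ _) fz.
    have [->|->] := (FcP arrA _ _).1 zu m Am; first by rewrite mul0r.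
    by rewrite mulrN oppr_le0 -expr2 sqr_ge0.
have y'q' : Fc y' q.
  apply/(FcP arrA) => k Ak; have [kq|kq] := eqVneq (ev k q) 0.
    by left; apply/sgr0P.
  by right; have [_ ->] := y'q k Ak.
have DE : D_of A prec x0 (Fc z) = Fc x1.
  rewrite /D_of yE y'E pE -qE; apply/(oppE arrA) => // k Ak; split=> kq.
    by have [-> //] := y'q k Ak; rewrite opprK.
  by rewrite (Fc_sg arrA xq Ak kq).
split; first by rewrite /sigma /tau yE DE pE -qE -e1E.
exists m, q, x1; split=> //; split=> //.
(* On [l] the reversals at [q] and at the edge cancel, so D is beyond [l] like C(F). *)
have [h _] := y'q l Al; have [h' _] := y'P l Al.
by rewrite -[LHS]opprK -h // h' // ly opprK.
Qed.

End Matching.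

(** * The relation F -> G as an incidence of cells *)

Section Steps.
Context {R : realType}.
Local Notation pt := (R * R)%type.
Context (A : set (set pt)) (arrA : arrangement A) (x0 : pt) (gx : generic A x0).
Context (M : set ((set pt * set pt) * (set pt * set pt))).
Context (em : euclidean_matching A x0 M).
Context (prec : set pt -> set pt -> Prop) (ep : euclidean_order A x0 prec).
Implicit Types (l m K S F G C : set pt) (x y z v w r q : pt) (t : R).
Local Notation Fc := (Fc A).
Local Notation off := (off A).
Local Notation on1 := (on1 A).
Local Notation line_of := (line_of arrA).
Local Notation x0_off := (x0_off arrA gx).
Local Notation tau := (tau A x0 prec).
Local Notation sigma := (sigma A x0 prec).

(** The case of a common line is the delicate one: if [m] does not separate [z] from [z'], then [z']
    is on the ray from [p] through [z], so both have equal signs on the lines through [p], and the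
    two edges coincide. *)
Lemma edges_meet_pt l l' m z z' p : on1 l z -> on1 l' z' -> A m -> m <> l ->
    ev l p = 0 -> ev m p = 0 -> Fc z p -> Fc z' p -> Fc z <> Fc z' ->
  Fc z `&` Fc z' = [set p].
Proof.
move=> o1 o1' Am ml lp mp zp zp' zz'.
have [Al lz _] := o1; have [Al' lz' _] := o1'.
apply/seteqP; split=> [y [zy zy']|_ ->] //=.
have on k u v : on1 k u -> Fc u v -> ev k v = 0.
  by move=> ok uv; apply/(lineE _ (line_of _)); [case: ok|apply: (on1_sub arrA ok)].
have ly := on _ _ _ o1 zy; have ly' := on _ _ _ o1' zy'.
have [ll'|/eqP ll'] := eqVneq l l'; last first.
  exact: (two_lines_pt arrA Al Al' ll' ly ly' lp (on _ _ _ o1' zp')).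
rewrite -ll' in o1' lz'.
have mz := on1_neq o1 Am ml; have mz' := on1_neq o1' Am ml.
have [e|e] := sgr_trichotomy mz' mz; last first.
  have my : ev m y = 0.
    apply/sgr0P; move/(FcP arrA)/(_ m Am): zy => [//|h].
    move/(FcP arrA)/(_ m Am): zy' => [//|]; rewrite h /sg e.
    by move=> /sgr_neq_oppr => /(_ mz).
  exact: (two_lines_pt arrA Al Am (nesym ml) ly my lp mp).
case: zz'; apply/(FcE arrA) => k Ak.
have [kp|kp] := eqVneq (ev k p) 0; last first.
  by rewrite -(Fc_sg arrA zp Ak kp) -(Fc_sg arrA zp' Ak kp).
rewrite (collinear_along arrA Al Am (nesym ml) lz' lp lz mp mz) /sg ev_along0 //.
rewrite sgrM [X in X * _]gtr0_sg ?mul1r //.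
by rewrite -sgr_gt0 sgrM sgrV e -expr2 exprn_even_gt0 //= sgr_eq0.
Qed.

(** Incidence asks that D(F) lie beyond |G|. If |G| = |F| this always holds. Otherwise D(F) and F
    are on opposite sides of |G|, so it holds exactly when F is on the side of C_0, which is
    condition (b). *)
Lemma edge_toP F G : edge A F -> edge A G ->
  edge_to A x0 F G <->
  [/\ F <> G, p_defined x0 F & sal_lt A (tau G) (sigma F)].
Proof.
move=> /(edgeP arrA)[[l z] /= o1 ->] /(edgeP arrA)[[l' z'] /= o1' ->].
have [Al lz uniq] := o1; have [Al' lz' uniq'] := o1'.
have [y' [oy' yz' ly' yE']] := C_of_ex arrA gx ep o1'.
have [zf|/contrapT zf] := pselect (~ Fc z (foot l x0)); last first.
  by split=> [/asboolP|] [_ /(p_definedE arrA x0 o1)].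
have [_ [m [p [x [[Am ml lp mp] zp pE [ox xp DE] [lx kx]]]]]] :=
  matched_edge arrA gx em ep o1 zf.
have pF := Fc_two_lines arrA Am Al ml mp lp.
have tG : tau (Fc z') = (Fc y', Fc z') by rewrite /tau yE'.
have sF : sigma (Fc z) = (Fc x, [set p]) by rewrite /sigma DE pE.
have half : ev l' p = 0 -> (affine_span (Fc z) = affine_span (Fc z') \/
    same_closed_half_plane (affine_span (Fc z')) (Fc z) (base_chamber A x0)) <->
    sg l' x = - sg l' x0.
  move=> l'p; rewrite (span_on1 arrA o1) (span_on1 arrA o1') (base_chamberE arrA gx).
  have [<-|/eqP l'l] := eqVneq l l'; first by split=> // _; left.
  rewrite (kx l' Al' (nesym l'l) l'p).
  have hp : same_closed_half_plane l' (Fc z) (Fc x0) <-> sg l' z = sg l' x0.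
    apply: same_closed_half_planeE; first exact: line_of.
    - by move=> u /(FcP arrA)/(_ l' Al').
    - exact: (@Fc_refl _ _ arrA).
    - by move=> u /(FcP arrA)/(_ l' Al').
    - exact: (@Fc_refl _ _ arrA).
    - exact: on1_neq o1 Al' (nesym l'l).
    - exact: x0_off.
  by split=> [[//|/hp ->]|/oppr_inj/hp] //; right.
have salG : sal A (Fc y', Fc z') by apply/(salP arrA); exists y', z'.
have salF : sal A (Fc x, [set p]) by apply/(salP arrA); exists x, p; rewrite pF.
rewrite /edge_to tG sF /sal_lt /= pE; split.
  move=> /asboolP[FG pd FGp side]; split=> //.
  have pG : Fc z' p by have [] : (Fc z `&` Fc z') p by rewrite FGp.
  have l'p : ev l' p = 0.
    by apply/(lineE _ (line_of Al')); apply: (on1_sub arrA o1').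
  split=> //.
    split=> [_ ->//|/(_ z' (@Fc_refl _ _ arrA _)) /= z'p].
    by apply: ml; rewrite -z'p in lp mp; rewrite (uniq' m Am mp) (uniq' l Al lp).
  apply/(dotE arrA) => // k Ak; split=> kz'.
    by rewrite (uniq' k Ak kz') ly'; apply/esym/half.
  by rewrite (Fc_sg arrA yz' Ak kz').
move=> [FG pd [_ _ [pG Gp] dE]]; apply/asboolP.
have pG' : Fc z' p by exact: pG.
have l'p : ev l' p = 0.
  by apply/(lineE _ (line_of Al')); apply: (on1_sub arrA o1').
split=> //; first exact: (edges_meet_pt o1 o1' Am ml).
apply/half => //; have [<- //] := (dotE arrA _ ox oy').1 dE l' Al'.
Qed.

End Steps.

(** * Local finiteness *)

Section LocalFiniteness.
Context {R : realType}.
Local Notation pt := (R * R)%type.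
Context (A : set (set pt)) (arrA : arrangement A).
Implicit Types (x y z v : pt).

(** One representative per code already yields the whole image. *)
Lemma finite_image_code (T U : choiceType) (J : finType) (V : set T) (f : T -> U)
    (code : T -> J) :
  (forall y y' : T, V y -> V y' -> code y = code y' -> f y = f y') ->
  finite_set (f @` V).
Proof.
move=> h; have [[v0 _]|/set0P/negP/negPn/eqP ->] := pselect (V !=set0); last first.
  by rewrite image_set0; exact: finite_set0.
pose g j := f (xget v0 [set y | V y /\ code y = j]).
apply: (@sub_finite_set _ _ (range g)); last exact/finite_image/finite_finset.
move=> _ [y Vy <-]; exists (code y) => //; rewrite /g.
have [Vy' cy'] := @xgetI _ v0 [set y' | V y' /\ code y' = code y] y (conj Vy erefl).
exact: h.
Qed.

(** On a small ball [V] (a square, for the maximum norm) only finitely many lines matter: by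
    convexity every other line has constant sign on [V]. So the signs on the list [s] determine the
    face. *)
Lemma faces_locally_finite x : exists U, [/\ open U, U x &
  finite_set [set G | face A G /\ G `&` U !=set0]].
Proof.
have [U [/nbhs_ballP[e /= e0 eU] /finite_seqP[s sE]]] := arrA.2 x.
pose V : set pt := ball x e; have VU : V `<=` U by [].
exists V^°; split; [exact: open_interior|exact: nbhsx_ballx|].
have convV y y' t : V y -> V y' -> 0 <= t <= 1 -> V (along y y' t).
  rewrite /V /ball /= => -[y1 y2] [y1' y2'] /andP[t0 t1].
  have key (a b c : R) : `|a - b| < e -> `|a - c| < e -> `|a - (b + t * (c - b))| < e.
    rewrite !ltr_norml => /andP[b1 b2] /andP[c1 c2].
    have conv u u' : 0 < u -> 0 < u' -> 0 < (1 - t) * u + t * u'.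
      move=> u0 u'0; have [->|t0'] := eqVneq t 0; first by lra.
      by rewrite ltr_wpDl ?mulr_ge0 ?mulr_gt0 ?subr_ge0 ?(ltW u0) // lt0r t0'.
    have := conv (e - (a - b)) (e - (a - c)); have := conv (e + (a - b)) (e + (a - c)).
    by move=> h1 h2; apply/andP; split; [have := h1 _ _|have := h2 _ _]; lra.
  by split; apply: key.
pose code y := [ffun i : 'I_(size s) =>
  (0 < ev (nth set0 s i) y, ev (nth set0 s i) y < 0)].
apply: (@sub_finite_set _ _ (Fc A @` V)); last first.
  apply: (@finite_image_code _ _ _ _ _ code) => y y' Vy Vy' cE.
  apply/(FcE arrA) => m Am; have [ms|ms] := boolP (m \in s).
    have im : (index m s < size s)%N by rewrite index_mem.
    move/ffunP/(_ (Ordinal im)): cE; rewrite !ffunE /= nth_index // => -[h1 h2].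
    apply/sgr_eqP; have [u|u|u] := ltrgtP (ev m y) 0.
    + by constructor 2; rewrite -h2.
    + by constructor 1; rewrite -h1.
    + constructor 3; split=> //; apply/eqP.
      by move: h1 h2; rewrite u ltxx eq_le !leNgt => <- <-.
  rewrite -[y'](along1 y); apply/esym/(@sg_along_const _ _ _ _ 1); last by rewrite lexx ler01.
  move=> t t01; apply/eqP => /(lineE _ (line_of arrA Am)) mt.
  suff : [set` s] m by rewrite /= (negbTE ms).
  by rewrite -sE; split=> //; exists (along y y' t); split=> //; apply/VU/convV.
move=> _ [[z ->] [v [zv Vv]]].
have [y [zy Vy]] := zv V Vv.
by exists y => //; apply/(FcE arrA)/(same_stratumE arrA).
Qed.

(* Compactness, applied to the filter of the sets of faces that contain
   some finite set. *)
Lemma faces_near_finite x (c : R) :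
  finite_set [set G | face A G /\ exists2 v, G v & sqd x v <= c].
Proof.
(* The half-width [c + 1] avoids a square root: if u^2 is at most c, then 2|u| is at most u^2 + 1,
   hence at most c + 1. *)
pose I (a : R) := `[a - (c + 1), a + (c + 1)]%classic.
pose K : set pt := I x.1 `*` I x.2.
have : compact K by apply: compact_setX; exact: segment_compact.
move=> /compact_near_coveringP cK.
pose large : set_system (set (set pt)) :=
  [set S | exists2 E0, finite_set E0 & forall E, E0 `<=` E -> S E].
have large_filter : Filter large.
  split; first by exists set0.
  - move=> S T [E0 f0 h0] [E1 f1 h1]; exists (E0 `|` E1); first by rewrite finite_setU.
    by move=> E; rewrite subUset => -[/h0 SE /h1].
  - by move=> S T ST [E0 f0 h0]; exists E0 => // E /h0 /ST.
have [y _|E fE KE] := cK _ large (fun E y => forall G, face A G -> G y -> E G) large_filter.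
  have [U [oU Uy fU]] := faces_locally_finite y.
  exists (U, [set E | [set G | face A G /\ G `&` U !=set0] `<=` E]).
    split; first exact: open_nbhs_nbhs.
    by exists [set G | face A G /\ G `&` U !=set0].
  by move=> [v E] [/= Uv EU] G fG Gv; apply: EU; split=> //; exists v.
apply: sub_finite_set fE => G [fG [v Gv vc]]; apply: (KE E _ v) => //.
have key (a b : R) : (a - b) ^+ 2 <= c -> I a b.
  move=> h; rewrite /I /= in_itv /=; have h1 := sqr_ge0 (a - b - 1).
  have h2 := sqr_ge0 (a - b + 1); have h3 := sqr_ge0 (a - b).
  by apply/andP; split; lra.
move: vc; rewrite /sqd => vc.
by split; apply: key; apply: le_trans vc; rewrite ?lerDl ?lerDr sqr_ge0.
Qed.

End LocalFiniteness.

Lemma finite_seqs_le (T : choiceType) (E : set T) n : finite_set E ->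
  finite_set [set q : seq T | (size q <= n)%N /\ forall x, x \in q -> E x].
Proof.
move=> fE; elim: n => [|n IH].
  apply: (@sub_finite_set _ _ [set [::]]); last exact: finite_set1.
  by move=> q [] /=; rewrite leqn0 => /nilP.
apply: (@sub_finite_set _ _ ([set [::]] `|` ((fun xq => xq.1 :: xq.2) @`
  (E `*` [set q : seq T | (size q <= n)%N /\ forall x, x \in q -> E x])))).
  move=> [|x q] [sq qE]; [by left|right; exists (x, q) => //].
  split=> /=; first by apply: qE; rewrite mem_head.
  by split=> // y yq; apply: qE; rewrite inE yq orbT.
rewrite finite_setU; split; first exact: finite_set1.
exact/finite_image/finite_setX.
Qed.

Lemma finite_uniq_seqs (T : choiceType) (E : set T) : finite_set E ->
  finite_set [set q : seq T | uniq q /\ forall x, x \in q -> E x].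
Proof.
move=> fE; have [s sE] := (finite_seqP _).1 fE.
apply: sub_finite_set (finite_seqs_le (size s) fE) => q [uq qE]; split=> //.
by apply: uniq_leq_size => // x /qE; rewrite sE.
Qed.

(** * Alternating paths and sequences of edges *)

Section Paths.
Context {R : realType}.
Local Notation pt := (R * R)%type.
Local Notation cell := (set pt * set pt)%type.
Context (A : set (set pt)) (arrA : arrangement A) (x0 : pt) (gx : generic A x0).
Context (M : set (cell * cell)).
Context (em : euclidean_matching A x0 M).
Context (prec : set pt -> set pt -> Prop) (ep : euclidean_order A x0 prec).
Implicit Types (l m K S F G C : set pt) (x y z v w r q : pt) (s t : cell).
Local Notation Fc := (Fc A).
Local Notation off := (off A).
Local Notation on1 := (on1 A).
Local Notation line_of := (line_of arrA).
Local Notation x0_off := (x0_off arrA gx).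
Local Notation tau := (tau A x0 prec).
Local Notation sigma := (sigma A x0 prec).
Local Notation S0 := (Sset A (Fc x0)).

(** A line containing the face of [t] also contains the smaller face of [s], so [t] has fewer signs
    to satisfy. *)
Lemma sal_lt_Sset s t : sal_lt A t s -> S0 s -> S0 t.
Proof.
move=> [/(salP arrA)[y [w [oy yw ->]]] /(salP arrA)[x [z [ox xz ->]]] /= [zw _] dE].
move=> /(SsetE arrA x0_off ox xz) Ss; apply/(SsetE arrA x0_off oy yw) => k Ak kw.
have [-> // _] := (dotE arrA w ox oy).1 dE k Ak; apply: Ss => //.
have wz : Fc w z by apply/zw/(@Fc_refl _ _ arrA).
apply/sgr0P; move/(FcP arrA)/(_ k Ak): wz => [//|e].
by rewrite -/(sg k z) e /sg kw sgr0.
Qed.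

Lemma matched_Sset s t : M (s, t) -> S0 s <-> S0 t.
Proof.
have [_ _ _ [prec' ep' h] _] := em; move=> /h e.
have c0 := Fc_chamber arrA x0_off.
split=> /(Nset_base arrA gx ep') /(eta_Nset_eq ep' c0) eE;
  apply/(Nset_base arrA gx ep'); apply: (eta_eq_Nset (@Fc_refl _ _ arrA x0));
  by rewrite -?e // e.
Qed.

Lemma alternating_Sset s c t : Defs.alternating A M s c t -> S0 s -> S0 t.
Proof.
elim: c s => [s [[st _] _]|e c IH s [[[st _] _] Me alt]] Ss.
  exact: sal_lt_Sset st Ss.
apply: IH alt _; apply/(matched_Sset Me); exact: sal_lt_Sset st Ss.
Qed.

Lemma tau_not_Sset F : edge A F -> ~ S0 (tau F).
Proof.
move=> /(edgeP arrA)[[l z] /= o1 ->]; have [Al lz _] := o1.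
have [y [oy yz ly yE]] := C_of_ex arrA gx ep o1; rewrite /tau yE.
move=> /(Nset_base arrA gx ep); rewrite -(base_chamberE arrA gx).
exact/(edge_Nset_base arrA gx ep o1 oy yz).
Qed.

Lemma critical_edge_tau t : critical A M t -> cell_dim t 1 ->
  edge A t.2 /\ t = tau t.2.
Proof.
case: t => C F ct dt; have [/(salP arrA)[y [z [oy yz [CE FE]]]] _] := ct.
have eF : edge A F by split=> //; rewrite FE; exact: Fc_face.
split=> //; rewrite {}CE {}FE in ct eF *.
have [[l z'] /= o1 zz'] := (edgeP arrA _).1 eF; rewrite zz' in ct *.
have yz' : Fc y z'.
  by apply: (Fc_sub arrA yz); rewrite zz'; exact: (@Fc_refl _ _ arrA).
have [ly _] := critical_edge arrA gx em o1 oy yz' ct.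
by rewrite /tau (C_ofE arrA gx ep o1 oy yz' ly).
Qed.

(** All 0-cells lie in S(C_0), and a cell strictly below a 2-cell is not a 2-cell; only 1-cells
    remain. *)
Lemma facet_not_Sset s t w : s.2 = [set w] -> sal_lt A t s -> ~ S0 t ->
  edge A t.2 /\ t = tau t.2.
Proof.
move=> sw [/(salP arrA)[y [z [oy yz ->]]] _ /= [wz zw] _ ] nS.
rewrite sw in wz zw.
have [oz|[l o1]|[l [m [Al Am lm lz mz]]]] := off_on1_or A z.
- by case: nS; rewrite (off_mem_eq arrA oz yz); exact: dim0_Sset.
- have eF : edge A (Fc z) by apply/(edgeP arrA); exists (l, z).
  split=> //; rewrite /tau (C_ofE arrA gx ep o1 oy yz) //.
  by apply/(edge_Nset_base arrA gx ep o1 oy yz); rewrite (base_chamberE arrA gx) (Nset_base arrA gx ep).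
- case: zw; rewrite (Fc_two_lines arrA Al Am lm lz mz) in wz *.
  by have /= <- := wz w erefl.
Qed.

Lemma covers_edge s w t : s.2 = [set w] -> sal_lt A t s -> edge A t.2 ->
  covers A s t.
Proof.
move=> sw ts et; split=> //; move=> [u [[_ su tu _] [_ _ us _]]].
have [[l z] /= o1 tz] := (edgeP arrA _).1 et; rewrite tz in tu.
have [x [q [_ _ uE]]] := (salP arrA _).1 su; rewrite uE /= in tu us.
have [_ [_ _ _ _ qE]] := face_proper_edge arrA o1 tu.
rewrite sw qE in us; have /= wq := us.1 w erefl.
by case: us.2; rewrite wq.
Qed.

Lemma matched_uniqr s s' t : M (s, t) -> M (s', t) -> s = s'.
Proof.
have [[_ u] _ _ _ _] := em => h h'.
by have [] := u t _ _ h h' (or_intror erefl) (or_intror erefl).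
Qed.

Lemma matched_uniql s t t' : M (s, t) -> M (s, t') -> t = t'.
Proof.
have [[_ u] _ _ _ _] := em => h h'.
by have [] := u s _ _ h h' (or_introl erefl) (or_introl erefl).
Qed.

Lemma matched_sigma F : edge A F -> p_defined x0 F -> M (sigma F, tau F).
Proof.
move=> /(edgeP arrA)[[l z] /= o1 ->] /(p_definedE arrA x0 o1) zf.
by have [] := matched_edge arrA gx em ep o1 zf.
Qed.

Lemma matched_tau F s : edge A F -> M (s, tau F) -> p_defined x0 F /\ s = sigma F.
Proof.
move=> eF Ms; suff pF : p_defined x0 F.
  by split=> //; apply: matched_uniqr Ms (matched_sigma eF pF).
have [[l z] /= o1 FE] := (edgeP arrA _).1 eF; rewrite FE in Ms *.
apply/(p_definedE arrA x0 o1) => zf.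
by have [_ /(_ _ Ms)[_]] := critical_foot arrA gx em ep o1 zf.
Qed.

(** The only partner of [sigma F] is [tau F], so excluding matched pairs means G <> F. *)
Lemma down_sigma F G : edge A F -> edge A G -> p_defined x0 F ->
  Defs.down A M (sigma F) (tau G) <-> edge_to A x0 F G.
Proof.
move=> eF eG pF; rewrite (edge_toP arrA gx em ep eF eG); split.
  move=> [[lt _] nM]; split=> // FG; apply: nM; rewrite -FG; exact: matched_sigma.
move=> [FG _ lt]; split; first exact: (covers_edge _ lt).
by move=> /(matched_uniql (matched_sigma eF pF)) [_ /FG].
Qed.

Definition up_step G : cell * cell := (tau G, sigma G).

Lemma up_step_inj : injective up_step. Proof. by move=> F G []. Qed.

Lemma alternatingP s w c F : s.2 = [set w] -> edge A F ->
  Defs.alternating A M s c (tau F) <-> exists q : seq (set pt), [/\ c = map up_step q,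
    forall G, G \in q -> edge A G, sorted (edge_to A x0) (rcons q F) &
    Defs.down A M s (tau (head F q))].
Proof.
move=> sw eF; split.
  elim: c s w sw => [s w sw alt|[t u] c IH s w sw /= [dt Mu alt]].
    by exists [::].
  (* A path entering S(C_0) would have to end there, but [tau F] is outside. *)
  have nSt : ~ S0 t.
    by move=> /(matched_Sset Mu)/(alternating_Sset alt); exact: tau_not_Sset.
  have [eG tE] : edge A t.2 /\ t = tau t.2.
    by apply: (facet_not_Sset sw _ nSt); case: dt => -[].
  set G := t.2 in eG tE; rewrite {}tE in dt Mu *.
  have [pG uE] := matched_tau eG Mu; rewrite {}uE in alt Mu *.
  have [q [-> qE qs qd]] := IH (sigma G) _ erefl alt.
  exists (G :: q); split=> //.
    by move=> G'; rewrite inE => /orP[/eqP ->|/qE].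
  have hE : edge A (head F q) by case: (q) qE => // G' q' qE; apply: qE; rewrite mem_head.
  have := (down_sigma eG hE pG).1 qd.
  by case: (q) qs => [|G' q'] /= qs' ->.
move=> [q []]; elim: q c s w sw => [c s w sw -> _ _ d //|G q IH c s w sw -> qE qs qd].
have eG : edge A G by apply: qE; rewrite mem_head.
have qE' G' : G' \in q -> edge A G' by move=> qG'; apply: qE; rewrite inE qG' orbT.
have hE : edge A (head F q) by case: (q) qE' => // G' q' h; apply: h; rewrite mem_head.
have [GH qs'] : edge_to A x0 G (head F q) /\ sorted (edge_to A x0) (rcons q F).
  by case: (q) qs => [|G' q'] /=; [rewrite andbT|move=> /andP[]].
have pG : p_defined x0 G by case/asboolP: GH.
split=> //=; first exact: matched_sigma.
by apply: (IH _ (sigma G) _ erefl) => //; apply/down_sigma.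
Qed.

(** [q] lists only the edges where the path goes up. The final [F], where it ends, is left out, so
    [size q] is the number of upward arrows. *)
Definition steps s F : set (seq (set pt)) :=
  [set q : seq (set pt) | [/\ forall G, G \in q -> edge A G, sorted (edge_to A x0) (rcons q F) &
    sal_lt A (tau (head F q)) s]].

Lemma down_critical s w F : critical A M s -> s.2 = [set w] -> edge A F ->
  Defs.down A M s (tau F) <-> sal_lt A (tau F) s.
Proof.
move=> [_ cs] sw eF; split=> [[[]]//|lt]; split; first exact: covers_edge sw lt eF.
by move=> /cs[].
Qed.

Lemma head_edge (q : seq (set pt)) F : edge A F -> (forall G, G \in q -> edge A G) -> edge A (head F q).
Proof. by case: q => // G q eF h; apply: h; rewrite mem_head. Qed.

Lemma alternating_pathsE s w F : critical A M s -> s.2 = [set w] -> edge A F ->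
  alternating_paths A M s (tau F) = map up_step @` steps s F.
Proof.
move=> cs sw eF; apply/seteqP; split=> c.
  move=> /(alternatingP _ sw eF)[q [-> qE qs /(down_critical cs sw (head_edge eF qE)) qd]].
  by exists q.
move=> [q [qE qs qd] <-]; apply/(alternatingP _ sw eF).
by exists q; split=> //; apply/(down_critical cs sw (head_edge eF qE)).
Qed.

Lemma edge_seqsE s F : edge A F ->
  edge_seqs A prec x0 s F = (rcons^~ F) @` steps s F.
Proof.
move=> eF; apply/seteqP; split=> q.
  case/lastP: q => [[]//|q G] [_ qE qs]; rewrite last_rcons => GF qd.
  rewrite {}GF in qE qs qd *; exists q => //; split=> //.
    by move=> G' qG'; apply: qE; rewrite mem_rcons inE qG' orbT.
  by case: (q) qd.
move=> [q' [qE qs qd] <-]; split=> //.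
- by case: (q').
- by move=> G; rewrite mem_rcons inE => /orP[/eqP ->|/qE].
- by rewrite last_rcons.
- by case: (q') qd.
Qed.

(** The length bound ensures that a repeated edge lifts to a nonempty directed cycle, against
    acyclicity. *)
Lemma arrow_path F (q : seq (set pt)) : (forall G, G \in F :: q -> edge A G) ->
  path (edge_to A x0) F q -> exists c : seq cell,
  [/\ path (arrow A M) (tau F) c, last (tau F) c = tau (last F q) &
      (size q <= size c)%N].
Proof.
elim: q F => [|G q IH] F qE /=; first by exists [::].
move=> /andP[FG /IH[]].
  by move=> G' qG'; apply: qE; rewrite inE qG' orbT.
move=> c [pc lc sc]; exists [:: sigma F, tau G & c]; split=> //=; last first.
  exact: leq_trans sc _.
have eF : edge A F by apply: qE; rewrite mem_head.
have eG : edge A G by apply: qE; rewrite !inE eqxx orbT.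
have pF : p_defined x0 F by case/asboolP: FG.
rewrite pc andbT; apply/andP; split; apply/asboolP.
  by right; exact: matched_sigma.
by left; apply/down_sigma.
Qed.

Lemma edge_path_uniq (q : seq (set pt)) : (forall G, G \in q -> edge A G) ->
  sorted (edge_to A x0) q -> uniq q.
Proof.
elim: q => [//|F q IH] qE pq /=; apply/andP; split; last first.
  by apply: IH (path_sorted pq) => G qG; apply: qE; rewrite inE qG orbT.
apply/negP => Fq; move: pq qE; case/splitPr: Fq => q1 q2.
rewrite /= -cat_rcons cat_path => /andP[p1 _] qE.
have [c [pc lc]] : exists c : seq cell,
    [/\ path (arrow A M) (tau F) c, last (tau F) c = tau (last F (rcons q1 F)) &
      (size (rcons q1 F) <= size c)%N].
  apply: arrow_path p1 => G; rewrite inE => GF; apply: qE.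
  by rewrite inE mem_cat orbA GF.
rewrite size_rcons last_rcons in lc *; case/lastP: c pc lc => // c u pc.
rewrite last_rcons => uE _; rewrite uE in pc.
by have [_ /(_ (tau F :: c) pc)] := em.
Qed.

Lemma p_of_closest F v : edge A F -> p_defined x0 F -> face A [set v] -> F v ->
  [/\ face A [set p_of A x0 F], F (p_of A x0 F) & sqd x0 (p_of A x0 F) <= sqd x0 v].
Proof.
move=> /(edgeP arrA)[[l z] /= o1 ->] pF fv zv; have [Al lz _] := o1.
have zf := (p_definedE arrA x0 o1).1 pF.
have [_ [m [p [x [[Am ml lp mp] zp pE _ _]]]]] := matched_edge arrA gx em ep o1 zf.
have fp : face A [set p] by rewrite -(Fc_two_lines arrA Am Al ml mp lp); exact: Fc_face.
have il := line_of Al.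
have lv : ev l v = 0 by apply/(lineE _ il); apply: (on1_sub arrA o1).
rewrite pE; split=> //; rewrite (foot_pythagoras x0 il lp) (foot_pythagoras x0 il lv).
rewrite lerD2l -le_dist -pE /p_of (span_on1 arrA o1) (proj_line x0 il).1.
case: xgetP => [q _ [_ /(_ v)]|/(_ p) h]; first exact.
(* Without a minimiser [p_of] would take its default value, the foot, which is not in the edge
   whereas [p] is. *)
case: h; have := pE; rewrite /p_of (span_on1 arrA o1) (proj_line x0 il).1.
case: xgetP => [q -> h <- //|_ fE]; by rewrite fE in zf.
Qed.

(** [p_of A x0 F] is at least as close to [x0] as [v] and is a vertex of the next edge, where it
    takes over the role of [v]. *)
Lemma edge_path_near (q : seq (set pt)) F v : (forall G, G \in F :: q -> edge A G) ->
    path (edge_to A x0) F q -> face A [set v] -> F v ->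
  forall G, G \in F :: q -> exists2 u, G u & sqd x0 u <= sqd x0 v.
Proof.
elim: q F v => [|G q IH] F v qE /=.
  by move=> _ fv Fv G; rewrite inE => /eqP ->; exists v.
move=> /andP[/asboolP[FG pF FGp _] pq] fv Fv H; rewrite inE => /orP[/eqP ->|Hq].
  by exists v.
have eF : edge A F by apply: qE; rewrite mem_head.
have [fp Fp pv] := p_of_closest eF pF fv Fv.
have Gp : G (p_of A x0 F) by have [] : (F `&` G) (p_of A x0 F) by rewrite FGp.
have [|u Hu uv] := IH G _ _ pq fp Gp H Hq.
  by move=> G' qG'; apply: qE; rewrite inE qG' orbT.
by exists u => //; exact: le_trans uv pv.
Qed.

(** The vertex [w] lies on the first edge, so every edge meets the disc around [x0] through [w]. *)
Lemma finite_steps s w F : sal A s -> s.2 = [set w] -> edge A F ->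
  finite_set (steps s F).
Proof.
move=> [_ fs _] sw eF; rewrite sw in fs.
apply: sub_finite_set (finite_uniq_seqs (faces_near_finite arrA x0 (sqd x0 w))) => q.
move=> [qE qs [_ _ [wq _] _]]; rewrite sw in wq.
have qE' G : G \in rcons q F -> edge A G.
  by rewrite mem_rcons inE => /orP[/eqP ->|/qE].
have uq := edge_path_uniq qE' qs.
split; first by move: uq; rewrite rcons_uniq => /andP[].
move=> G qG; have GrF : G \in rcons q F by rewrite mem_rcons inE qG orbT.
split; first by case: (qE _ qG).
case: q qE' qs wq GrF {uq qE qG} => [|H q] /= qE qs wq GrF;
  by apply: edge_path_near GrF => //; apply: wq.
Qed.

End Paths.

(** * Weights of alternating paths *)

Section Weights.
Context {L : comUnitRingType} {T : Type} (f : T -> T -> L).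
Implicit Types (s t : T) (c : seq (T * T)).

(** The formula of [path_weight] over any commutative ring with units: comparing the two weights is
    purely formal. *)
Definition zigzag s t c : L :=
  let k := size c in
  let sigma i := nth s (s :: unzip2 c) i in
  let tau i := nth s (s :: unzip1 c) i in
  (-1) ^+ k * f (sigma k) t *
  \prod_(1 <= i < k.+1) (f (sigma i.-1) (tau i) * (f (sigma i) (tau i))^-1).

Lemma zigzag_cons s t (e : T * T) c :
  zigzag s t (e :: c) = - (f s e.1 / f e.2 e.1) * zigzag e.2 t c.
Proof.
(* Only the default of [nth] changes, from [e.2] to [s]; every index is in range. *)
have -> : zigzag e.2 t c = (-1) ^+ size c *
    f (nth s (e.2 :: unzip2 c) (size c)) t *
    \prod_(1 <= i < (size c).+1) (f (nth s (e.2 :: unzip2 c) i.-1)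
      (nth s (e.2 :: unzip1 c) i) *
      (f (nth s (e.2 :: unzip2 c) i) (nth s (e.2 :: unzip1 c) i))^-1).
  rewrite /zigzag; congr (_ * _ * _).
    by congr (f _ t); apply: set_nth_default; rewrite /= size_map.
  apply: eq_big_nat => -[//|i] ic; have ic' : (i < size c)%N := ic.
  by congr (f _ _ / f _ _); apply: set_nth_default; rewrite /= size_map ?ltnS ?(ltnW ic').
rewrite /zigzag /= [in LHS]big_nat_recl // !big_add1 /= exprS.
ring.
Qed.

(** A regrouping of factors: a path pairs each upward arrow with the descent before it, an edge
    weight pairs it with the descent after it. The first descent is then left over instead of the
    last. *)
Lemma zigzag_steps (U : Type) (tau sigma : U -> T) s u (q : seq U) :
  let r := rcons q u in
  zigzag s (tau u) [seq (tau g, sigma g) | g <- q] =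
  (-1) ^+ size q * f s (tau (head u r)) *
  \prod_(i < size q) (f (sigma (nth u r i)) (tau (nth u r i.+1)) /
                      f (sigma (nth u r i)) (tau (nth u r i))).
Proof.
move=> /=; elim: q s => [|g q IH] s.
  by rewrite /zigzag /= big_geq // big_ord0.
rewrite /= zigzag_cons IH /= big_ord_recl /= exprS.
have -> : nth u (rcons q u) 0 = head u (rcons q u) by case: (q).
under [in RHS]eq_bigr => i _ do rewrite /bump /= add1n.
ring.
Qed.

End Weights.

(** Finiteness of the index sets belongs to the conclusion because a sum [\sum_(q \in _)] with
    infinite support is 0 by convention. *)
Theorem theorem7p7 (R : realType) (A : set (set (R * R))) (x0 : R * R)
    (M : set ((set (R * R) * set (R * R)) * (set (R * R) * set (R * R))))
    (prec : set (R * R) -> set (R * R) -> Prop)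
    (inc : set (R * R) * set (R * R) -> set (R * R) * set (R * R) -> int)
    (D C F : set (R * R)) (p : R * R) :
  arrangement A ->
  generic A x0 ->
  euclidean_matching A x0 M ->
  euclidean_order A x0 prec ->
  incidence A inc ->
  oriented A x0 prec inc ->
  critical A M (D, [set p]) -> cell_dim (D, [set p]) 2 ->
  critical A M (C, F) -> cell_dim (C, F) 1 ->
  [/\ finite_set (alternating_paths A M (D, [set p]) (C, F)),
      finite_set (edge_seqs A prec x0 (D, [set p]) F)
    & morse_inc A M x0 inc (D, [set p]) (C, F) =
      \sum_(q \in edge_seqs A prec x0 (D, [set p]) F)
        seq_weight A prec x0 inc (D, [set p]) F q].
Proof.
move=> arrA gx em ep _ _ cs _ ct dt.
have [eF tE] := critical_edge_tau arrA gx em ep ct dt; rewrite /= in eF tE.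
rewrite {}tE in ct *.
have s2 : (D, [set p]).2 = [set p] by [].
have fin : finite_set (steps A x0 prec (D, [set p]) F).
  by have [sD _] := cs; exact: (finite_steps arrA gx em ep sD s2 eF).
have altE := alternating_pathsE arrA gx em ep cs s2 eF.
have seqE := @edge_seqsE _ A x0 prec (D, [set p]) F eF.
split.
- by rewrite altE; exact: finite_image.
- by rewrite seqE; exact: finite_image.
have injU : set_inj (steps A x0 prec (D, [set p]) F) (map (up_step A x0 prec)).
  by move=> q q' _ _; exact: (inj_map (@up_step_inj _ A x0 prec)).
have injR : set_inj (steps A x0 prec (D, [set p]) F) (rcons^~ F).
  by move=> q q' _ _ /rcons_inj[].
rewrite /morse_inc altE seqE.
rewrite (fsbig_image _ _ _ injU).
rewrite [RHS](fsbig_image _ _ _ injR).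
apply: eq_fsbigr => q _.
rewrite /path_weight.
rewrite /seq_weight size_rcons.
rewrite /edge_weight.
(* [path_weight] is [zigzag] for [tinc], and both exponents of -1 are [size q]. *)
exact: zigzag_steps.
Qed.
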